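(* Let $R>1$, $\nu\ge 0$, and $k\in\{1,2,\dots\}$. Then $$a_{\nu,k}<\frac{\pi k}{R-1}+\frac{\pi\nu}{2R}.$$
   Context: For $\nu\ge 0$ and $R>1$, let $f_{\nu,R}(z)=J_\nu(Rz)Y_\nu(z)-J_\nu(z)Y_\nu(Rz)$ for $z>0$, where $J_\nu$ and $Y_\nu$ are the Bessel functions of the first and second kind of order $\nu$. It is well known that $f_{\nu,R}$ has infinitely many positive zeros, all simple; $a_{\nu,k}$ denotes the $k$-th positive zero in increasing order, $k=1,2,\dots$ ($R$ is suppressed in the notation). *)

(* Defs.v *)
From Stdlib Require Import Reals List Factorial.
From Coquelicot Require Import Coquelicot.
Open Scope R_scope.

(** [1 / Gamma x] for every real [x], by Gauss's limit.  This is an entire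
    function, equal to 0 at the poles 0, -1, -2, ... of [Gamma]. *)
Definition rgamma (x : R) : R :=
  real (Lim_seq (fun n =>
    prod_f_R0 (fun k => x + INR k) n / (INR (fact n) * Rpower (INR n) x))).

(** [sum_m (-1)^m / (m! Gamma (m + nu + 1)) (z/2)^(2m + nu)], for any real
    order [nu]; meaningful for [0 < z] because of [Rpower]. *)
Definition bessel_J (nu z : R) : R :=
  Rpower (z / 2) nu *
  PSeries (fun m => (-1) ^ m / INR (fact m) * rgamma (INR m + nu + 1))
          ((z / 2) ^ 2).

Definition bessel_Y_nonint (nu z : R) : R :=
  (bessel_J nu z * cos (nu * PI) - bessel_J (- nu) z) / sin (nu * PI).

(** [frac_part nu = 0] says that [nu] is an integer; the value is then the
    limit of the quotient as the order tends to [nu]. *)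
Definition bessel_Y (nu z : R) : R :=
  if Req_dec_T (frac_part nu) 0
  then real (Lim (fun mu => bessel_Y_nonint mu z) nu)
  else bessel_Y_nonint nu z.

Definition bessel_cross (nu r z : R) : R :=
  bessel_J nu (r * z) * bessel_Y nu z - bessel_J nu z * bessel_Y nu (r * z).

(** [a] is the [k]-th positive zero of [f], counted from [k = 1]: it is a
    positive zero and [f] has exactly [k - 1] zeros in [(0, a)], listed
    in [l]. *)
Definition is_kth_pos_zero (f : R -> R) (k : nat) (a : R) : Prop :=
  0 < a /\ f a = 0 /\
  exists l : list R,
    NoDup l /\ S (length l) = k /\
    forall z : R, In z l <-> 0 < z < a /\ f z = 0.

(* Main.v *)
Require Import Defs.
From Stdlib Require Import Reals Lra Lia List Factorial Compare_dec Ranalysis5.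
From Coquelicot Require Import Coquelicot.
Open Scope R_scope.

(** Put [B = PI k / (r - 1) + PI nu / (2 r)].  It suffices to find [k] distinct
    zeros of the cross product in [(0, B)]: a [k]-th zero [a >= B] would have all
    of them among the [k - 1] zeros below it.

    Up to a nonzero constant the cross product is
    [u1 (r z) u2 z - u1 z u2 (r z)] for two independent solutions [u1], [u2] of
    Bessel's equation ([bessel_cross_pair]).  With polar coordinates
    [(u1, u2) = M (cos th, sin th)] it is a nonvanishing factor times
    [sin (th (r z) - th z)] ([phase_formula]), so its zeros are the points where
    [Phi z = th (r z) - th z] is a multiple of [PI].  Near [0] the function [J] is
    positive, which keeps [Phi] below [PI]; hence [Phi B > k PI] and the
    intermediate value theorem give the [k] zeros.

    To bound [Phi B] from below, compare with the Debye phase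
    [F x = sqrt (x^2 - nu^2) - nu acos (nu / x)], defined for [x > nu].  The
    function [(x^2 - nu^2)^(-1/4) sin (F x - F s)] satisfies an equation that
    oscillates strictly more slowly than Bessel's, for every [nu >= 0], so by
    Sturm's comparison argument [th] grows by more than [PI] whenever [F] grows
    by [PI] ([sturm_step], [sturm_comparison]).  The elementary inequalities
    [F B <= F (r B) / r] and [F x >= x - PI nu / 2] then give
    [F (r B) - F B >= (1 - 1/r) (r B - PI nu / 2) = k PI]
    ([debye_phase_increment]), which is where the value of [B] comes from.

    The rest connects this with the actual Bessel functions.  [J] solves Bessel's
    equation because it is a Frobenius series whose coefficients obey the
    recurrence inherited from [1 / Gamma x = x / Gamma (x + 1)].  At a nonintegral
    order the second solution is [J] of the opposite order.  At an integer [n] the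
    limit defining [Y] is computed explicitly as a combination of [J] and
    Frobenius's logarithmic solution ([bessel_Y_nat]).  This uses only Lipschitz
    bounds for [1 / Gamma] at [1]: an unknown multiple of [J] remains in [Y], and it
    cancels in the cross product. *)

(** * Calculus on the half-line *)

Lemma Derive_value (f : R -> R) (x l : R) :
  is_derive f x l -> Derive (fun t => f t) x = l.
Proof. apply is_derive_unique. Qed.

Lemma constant_of_derive_0 (f : R -> R) :
  (forall x, 0 < x -> is_derive f x 0) ->
  forall x y, 0 < x -> 0 < y -> f x = f y.
Proof.
  intros Hf.
  assert (H : forall x y, 0 < x -> x < y -> f x = f y).
  { intros x y Hx Hxy. apply (eq_is_derive f x y); [|lra].
    intros t Ht. apply Hf. lra. }
  intros x y Hx Hy. destruct (Rtotal_order x y) as [h|[h|h]].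
  - now apply H.
  - now subst.
  - symmetry. now apply H.
Qed.

Lemma mean_value (f df : R -> R) (a b : R) :
  a < b -> (forall x, a <= x <= b -> is_derive f x (df x)) ->
  exists c, a < c < b /\ f b - f a = df c * (b - a).
Proof.
  intros Hab Hf.
  destruct (MVT_cor2 f df a b Hab) as [c [Hc1 Hc2]].
  - intros c Hc. apply is_derive_Reals. now apply Hf.
  - now exists c.
Qed.

Lemma intermediate_value (f : R -> R) (a b c : R) :
  a < b -> (forall x, a <= x <= b -> ex_derive f x) -> f a < c < f b ->
  exists x, a < x < b /\ f x = c.
Proof.
  intros Hab Hf Hc.
  destruct (IVT_interv (fun x => f x - c) a b) as [x [Hx1 Hx2]]; try lra.
  - intros x Hx. apply continuity_pt_filterlim.
    apply (ex_derive_continuous (fun x => f x - c)).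
    auto_derive. now apply Hf.
  - exists x. split; [|lra].
    assert (x <> a) by (intros ->; lra).
    assert (x <> b) by (intros ->; lra).
    lra.
Qed.

(** * Bessel's equation and the phase of a pair of solutions *)

Definition bessel_solution (nu : R) (u v : R -> R) : Prop :=
  forall x, 0 < x ->
    is_derive u x (v x / x) /\ is_derive v x (- ((x ^ 2 - nu ^ 2) / x) * u x).

(** As [v = x u'], this is [x] times the usual Wronskian, hence constant on
    solutions. *)
Definition wronskian (u1 v1 u2 v2 : R -> R) (x : R) : R :=
  u1 x * v2 x - v1 x * u2 x.

Lemma wronskian_constant (nu : R) (u1 v1 u2 v2 : R -> R) :
  bessel_solution nu u1 v1 -> bessel_solution nu u2 v2 ->
  forall x y, 0 < x -> 0 < y ->
  wronskian u1 v1 u2 v2 x = wronskian u1 v1 u2 v2 y.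
Proof.
  intros H1 H2. apply constant_of_derive_0. intros x Hx.
  destruct (H1 x Hx) as [Hu1 Hv1], (H2 x Hx) as [Hu2 Hv2].
  unfold wronskian. auto_derive.
  - repeat split; eexists; eassumption.
  - rewrite (Derive_value _ _ _ Hu1), (Derive_value _ _ _ Hv1),
      (Derive_value _ _ _ Hu2), (Derive_value _ _ _ Hv2).
    field. lra.
Qed.

(** The polar angle of the curve [(u1, u2)] has derivative
    [(u1 u2' - u1' u2) / (u1^2 + u2^2)], and the numerator is [w / x]. *)
Definition phase_function (w : R) (u1 u2 th : R -> R) : Prop :=
  forall x, 0 < x -> is_derive th x (w / (x * (u1 x ^ 2 + u2 x ^ 2))).

Definition positive_pair (nu w : R) (u1 v1 u2 v2 : R -> R) : Prop :=
  bessel_solution nu u1 v1 /\ bessel_solution nu u2 v2 /\ 0 < w /\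
  forall x, 0 < x -> wronskian u1 v1 u2 v2 x = w.

Lemma square_amplitude_pos nu w u1 v1 u2 v2 :
  positive_pair nu w u1 v1 u2 v2 ->
  forall x, 0 < x -> 0 < u1 x ^ 2 + u2 x ^ 2.
Proof.
  intros (_ & _ & Hw & HW) x Hx. specialize (HW x Hx). unfold wronskian in HW.
  destruct (Req_dec (u1 x) 0) as [h|h].
  - destruct (Req_dec (u2 x) 0) as [h2|h2].
    + rewrite h, h2 in HW. lra.
    + assert (0 < u2 x ^ 2) by (apply pow2_gt_0; auto). nra.
  - assert (0 < u1 x ^ 2) by (apply pow2_gt_0; auto). nra.
Qed.

Lemma phase_function_exists nu w u1 v1 u2 v2 :
  positive_pair nu w u1 v1 u2 v2 -> exists th, phase_function w u1 u2 th.
Proof.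
  intros HP.
  pose proof (square_amplitude_pos _ _ _ _ _ _ HP) as Hm.
  destruct HP as (H1 & H2 & Hw & _).
  set (g := fun x => w / (x * (u1 x ^ 2 + u2 x ^ 2))).
  assert (Hg : forall x, 0 < x -> continuous g x).
  { intros x Hx. apply (ex_derive_continuous g). unfold g.
    destruct (H1 x Hx) as [Hu1 _], (H2 x Hx) as [Hu2 _].
    auto_derive. specialize (Hm x Hx). simpl in Hm.
    repeat split; try (eexists; eassumption).
    intros h. apply Rmult_integral in h. lra. }
  exists (RInt g 1). intros x Hx.
  apply (is_derive_RInt g (RInt g 1) 1 x).
  - assert (Hx2 : 0 < x / 2) by lra.
    exists (mkposreal _ Hx2). intros y Hy.
    apply (RInt_correct g 1 y).
    apply (ex_RInt_continuous g).
    intros z [Hz _]. apply Hg.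
    unfold ball in Hy; simpl in Hy; unfold AbsRing_ball, abs, minus, plus, opp in Hy; simpl in Hy.
    apply Rabs_def2 in Hy. revert Hz. unfold Rmin. destruct Rle_dec; lra.
  - now apply Hg.
Qed.

(** The unit vector [(u1, u2) / M] rotates with angular velocity [th'], so rotating
    it back by the angle [th] gives a constant vector [(c, d)]. *)
Lemma phase_formula nu w u1 v1 u2 v2 th :
  positive_pair nu w u1 v1 u2 v2 -> phase_function w u1 u2 th ->
  forall x y, 0 < x -> 0 < y ->
  u1 x * u2 y - u1 y * u2 x =
  sqrt (u1 x ^ 2 + u2 x ^ 2) * sqrt (u1 y ^ 2 + u2 y ^ 2) * sin (th y - th x).
Proof.
  intros HP Hth.
  pose proof (square_amplitude_pos _ _ _ _ _ _ HP) as Hm.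
  destruct HP as (H1 & H2 & Hw & HW).
  set (m := fun x => sqrt (u1 x ^ 2 + u2 x ^ 2)).
  set (c := fun x => (cos (th x) * u1 x + sin (th x) * u2 x) / m x).
  set (d := fun x => (cos (th x) * u2 x - sin (th x) * u1 x) / m x).
  assert (Hmm : forall x, 0 < x -> 0 < m x /\ m x * m x = u1 x ^ 2 + u2 x ^ 2).
  { intros x Hx. specialize (Hm x Hx). split.
    - now apply sqrt_lt_R0.
    - apply sqrt_sqrt. lra. }
  assert (Hder : forall x, 0 < x -> is_derive c x 0 /\ is_derive d x 0).
  { intros x Hx.
    destruct (H1 x Hx) as [Hu1 _], (H2 x Hx) as [Hu2 _].
    specialize (Hth x Hx). specialize (HW x Hx).
    destruct (Hmm x Hx) as [Hm1 Hm2]. specialize (Hm x Hx).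
    assert (Em : is_derive m x ((u1 x * v1 x + u2 x * v2 x) / (x * m x))).
    { unfold m. auto_derive.
      - repeat split; try (eexists; eassumption). simpl in Hm. lra.
      - rewrite (Derive_value _ _ _ Hu1), (Derive_value _ _ _ Hu2).
        replace (u1 x * (u1 x * 1) + u2 x * (u2 x * 1)) with (u1 x ^ 2 + u2 x ^ 2) by ring.
        fold (m x). field. lra. }
    assert (Hth' : is_derive th x (w / (x * (m x * m x)))).
    { now rewrite Hm2. }
    clearbody m.
    split; unfold c, d; auto_derive.
    all: try (repeat split; try (eexists; eassumption); lra).
    all: rewrite (Derive_value _ _ _ Hu1), (Derive_value _ _ _ Hu2),
        (Derive_value _ _ _ Hth'), (Derive_value _ _ _ Em).
    all: rewrite <- HW; unfold wronskian.
    all: field_simplify_eq; [|lra].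
    all: replace (m x ^ 2) with (u1 x ^ 2 + u2 x ^ 2) by (rewrite <- Hm2; ring); ring. }
  assert (Hc : forall x y, 0 < x -> 0 < y -> c x = c y)
    by (apply constant_of_derive_0; intros; now apply Hder).
  assert (Hd : forall x y, 0 < x -> 0 < y -> d x = d y)
    by (apply constant_of_derive_0; intros; now apply Hder).
  assert (E : forall x, 0 < x ->
    u1 x = m x * (c x * cos (th x) - d x * sin (th x)) /\
    u2 x = m x * (c x * sin (th x) + d x * cos (th x)) /\ c x ^ 2 + d x ^ 2 = 1).
  { intros x Hx. destruct (Hmm x Hx) as [Hm1 Hm2].
    pose proof (sin2_cos2 (th x)) as Hs. unfold Rsqr in Hs.
    unfold c, d. repeat split; field_simplify_eq; try lra.
    - replace (sin (th x) ^ 2) with (1 - cos (th x) ^ 2) by lra. ring.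
    - replace (sin (th x) ^ 2) with (1 - cos (th x) ^ 2) by lra. ring.
    - replace (sin (th x) ^ 2) with (1 - cos (th x) ^ 2) by lra.
      replace (m x ^ 2) with (u1 x ^ 2 + u2 x ^ 2) by (rewrite <- Hm2; ring). ring. }
  intros x y Hx Hy. fold (m x) (m y).
  destruct (E x Hx) as (E1 & E2 & E3), (E y Hy) as (F1 & F2 & _).
  rewrite (Hc y x Hy Hx), (Hd y x Hy Hx) in F1, F2.
  rewrite E1, E2, F1, F2, sin_minus.
  transitivity (m x * m y * (c x ^ 2 + d x ^ 2) *
    (sin (th y) * cos (th x) - cos (th y) * sin (th x))); [ring|].
  rewrite E3. ring.
Qed.

Lemma phase_increasing nu w u1 v1 u2 v2 th :
  positive_pair nu w u1 v1 u2 v2 -> phase_function w u1 u2 th ->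
  forall x y, 0 < x -> x < y -> th x < th y.
Proof.
  intros HP Hth x y Hx Hxy.
  destruct (mean_value th _ x y Hxy (fun t Ht => Hth t (Rlt_le_trans _ _ _ Hx (proj1 Ht))))
    as [t [Ht E]].
  pose proof (square_amplitude_pos _ _ _ _ _ _ HP t ltac:(lra)) as Hm.
  destruct HP as (_ & _ & Hw & _).
  assert (0 < w / (t * (u1 t ^ 2 + u2 t ^ 2)) * (y - x)); [|lra].
  apply Rmult_lt_0_compat; [|lra]. apply Rdiv_lt_0_compat; [lra|].
  apply Rmult_lt_0_compat; lra.
Qed.

(** Where [u1 > 0] the phase is [atan (u2 / u1)] up to a constant, and [atan] takes
    its values in an interval of length [PI]. *)
Lemma phase_increment_lt_PI nu w u1 v1 u2 v2 th :
  positive_pair nu w u1 v1 u2 v2 -> phase_function w u1 u2 th ->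
  forall x y, 0 < x -> x < y -> (forall t, x <= t <= y -> 0 < u1 t) ->
  th y - th x < PI.
Proof.
  intros HP Hth x y Hx Hxy Hpos.
  destruct (mean_value (fun t => th t - atan (u2 t / u1 t)) (fun _ => 0) x y Hxy)
    as [t [Ht E]].
  { intros t Ht. assert (Ht0 : 0 < t) by lra.
    pose proof (square_amplitude_pos _ _ _ _ _ _ HP t Ht0) as Hm.
    destruct HP as (H1 & H2 & Hw & HW).
    destruct (H1 t Ht0) as [Hu1 _], (H2 t Ht0) as [Hu2 _].
    specialize (Hth t Ht0). specialize (HW t Ht0). specialize (Hpos t Ht).
    auto_derive.
    - repeat split; try (eexists; eassumption). lra.
    - rewrite (Derive_value _ _ _ Hu1), (Derive_value _ _ _ Hu2),
        (Derive_value _ _ _ Hth), <- HW. unfold wronskian, Rsqr. field.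
      repeat split; try lra. }
  pose proof (atan_bound (u2 x / u1 x)). pose proof (atan_bound (u2 y / u1 y)). lra.
Qed.

(** * The Debye phase *)

(** The leading term of the large-order phase of the Bessel functions; its derivative is
    [sqrt (x^2 - nu^2) / x]. *)
Definition debye_phase (nu x : R) : R := sqrt (x ^ 2 - nu ^ 2) - nu * acos (nu / x).

Lemma ratio_bounds (nu x : R) : 0 <= nu -> nu < x -> 0 <= nu / x < 1.
Proof.
  intros H1 H2. split.
  - apply Rdiv_le_0_compat; lra.
  - apply Rmult_lt_reg_r with x; [lra|]. unfold Rdiv.
    rewrite Rmult_assoc, Rinv_l; lra.
Qed.

Lemma sqrt_cofactor (nu x : R) : 0 < x ->
  sqrt (x ^ 2 - nu ^ 2) = x * sqrt (1 - Rsqr (nu / x)).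
Proof.
  intros Hx.
  replace (x ^ 2 - nu ^ 2) with (Rsqr x * (1 - Rsqr (nu / x))).
  - rewrite sqrt_mult_alt; [|apply Rle_0_sqr]. rewrite sqrt_Rsqr; lra.
  - unfold Rsqr. field. lra.
Qed.

Lemma debye_phase_derive (nu x : R) : 0 <= nu -> nu < x ->
  is_derive (debye_phase nu) x (sqrt (x ^ 2 - nu ^ 2) / x).
Proof.
  intros Hnu Hx. assert (Hx0 : 0 < x) by lra.
  pose proof (ratio_bounds nu x Hnu Hx) as Hr.
  assert (Ha : is_derive acos (nu / x) (-1 / sqrt (1 - Rsqr (nu / x)))).
  { apply is_derive_Reals.
    assert (Hr' : -1 < nu / x < 1) by lra.
    rewrite <- (derive_pt_acos _ Hr').
    exact (proj1 (derive_pt_eq _ _ _ _) eq_refl). }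
  assert (HP : 0 < x ^ 2 - nu ^ 2) by nra.
  assert (Hs : 0 < 1 - Rsqr (nu / x)) by (unfold Rsqr; nra).
  unfold debye_phase. auto_derive.
  - repeat split; [lra|eexists; exact Ha|lra].
  - change (nu * / x) with (nu / x).
    rewrite (Derive_value _ _ _ Ha).
    replace (x * (x * 1) + - (nu * (nu * 1))) with (x ^ 2 - nu ^ 2) by ring.
    rewrite (sqrt_cofactor nu x Hx0) in *.
    set (s := sqrt (1 - Rsqr (nu / x))) in *.
    assert (Es : s * s = 1 - Rsqr (nu / x)) by (apply sqrt_sqrt; lra).
    assert (Hs0 : 0 < s) by (apply sqrt_lt_R0; lra).
    clearbody s. unfold Rsqr in Es.
    assert (Es2 : s ^ 2 * x ^ 2 = x ^ 2 - nu ^ 2).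
    { replace (s ^ 2) with (s * s) by ring. rewrite Es. field. lra. }
    field_simplify_eq; [|split; lra]. nra.
Qed.

Lemma debye_phase_increasing (nu x y : R) :
  0 <= nu -> nu < x -> x < y -> debye_phase nu x < debye_phase nu y.
Proof.
  intros Hnu Hx Hxy.
  destruct (mean_value (debye_phase nu) (fun t => sqrt (t ^ 2 - nu ^ 2) / t) x y Hxy)
    as [t [Ht E]].
  - intros t Ht. apply debye_phase_derive; lra.
  - assert (0 < sqrt (t ^ 2 - nu ^ 2) / t * (y - x)); [|lra].
    apply Rmult_lt_0_compat; [|lra].
    apply Rdiv_lt_0_compat; [|lra]. apply sqrt_lt_R0. nra.
Qed.

(** With [nu = x cos c] the Debye phase is [x] times this function of [c], which
    turns inequalities between Debye phases into trigonometric ones. *)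
Definition polar_profile (c : R) := sin c - c * cos c.

Lemma debye_phase_polar (nu x : R) : 0 <= nu -> nu < x ->
  debye_phase nu x = x * polar_profile (acos (nu / x)).
Proof.
  intros Hnu Hx. pose proof (ratio_bounds nu x Hnu Hx) as Hr.
  unfold debye_phase, polar_profile. rewrite sqrt_cofactor by lra.
  rewrite sin_acos, cos_acos by lra. field. lra.
Qed.

Lemma acos_ratio_bounds (nu x : R) : 0 <= nu -> nu < x -> 0 < acos (nu / x) <= PI / 2.
Proof.
  intros Hnu Hx. pose proof (ratio_bounds nu x Hnu Hx) as Hr.
  rewrite acos_asin by lra.
  split.
  - pose proof (acos_bound_lt (nu / x) ltac:(lra)). rewrite acos_asin in H by lra. lra.
  - rewrite asin_acos by lra.
    destruct (Rle_dec (acos (nu / x)) (PI / 2)) as [h|h]; [lra|].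
    pose proof (acos_bound (nu / x)).
    assert (cos (acos (nu / x)) < 0) by (apply cos_lt_0; lra).
    rewrite cos_acos in H0; lra.
Qed.

Lemma polar_profile_increasing (a b : R) : 0 <= a -> a < b -> b <= PI / 2 -> polar_profile a < polar_profile b.
Proof.
  intros Ha Hab Hb.
  destruct (mean_value polar_profile (fun t => t * sin t) a b Hab) as [t [Ht E]].
  - intros t Ht. unfold polar_profile. auto_derive; [easy|ring].
  - assert (0 < t * sin t * (b - a)); [|lra].
    pose proof PI_RGT_0.
    repeat apply Rmult_lt_0_compat; try lra. apply sin_gt_0; lra.
Qed.

(** The difference of the two sides is [sin c + (PI/2 - c) cos c - 1], which decreases
    to [0] at [PI/2]. *)
Lemma polar_profile_lower (c : R) : 0 <= c < PI / 2 -> 1 - PI / 2 * cos c < polar_profile c.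
Proof.
  intros Hc.
  destruct (mean_value (fun t => sin t + (PI / 2 - t) * cos t)
    (fun t => - ((PI / 2 - t) * sin t)) c (PI / 2) ltac:(lra)) as [t [Ht E]].
  - intros t Ht. auto_derive; [easy|unfold Rdiv; ring].
  - rewrite sin_PI2, cos_PI2 in E. unfold polar_profile.
    assert (0 < (PI / 2 - t) * sin t * (PI / 2 - c)); [|lra].
    repeat apply Rmult_lt_0_compat; try lra. apply sin_gt_0; lra.
Qed.

Lemma debye_phase_lower (nu x : R) : 0 < nu -> nu < x ->
  x - PI * nu / 2 < debye_phase nu x.
Proof.
  intros Hnu Hx. pose proof (ratio_bounds nu x ltac:(lra) Hx) as Hr.
  pose proof (acos_ratio_bounds nu x ltac:(lra) Hx) as Hc.
  rewrite debye_phase_polar by lra.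
  assert (0 < nu / x) by (apply Rdiv_lt_0_compat; lra).
  assert (Hne : acos (nu / x) <> PI / 2).
  { intros h. pose proof (cos_acos (nu / x) ltac:(lra)) as hc.
    rewrite h, cos_PI2 in hc. lra. }
  pose proof (polar_profile_lower (acos (nu / x)) ltac:(lra)) as Hp.
  rewrite cos_acos in Hp by lra.
  replace (x - PI * nu / 2) with (x * (1 - PI / 2 * (nu / x))) by (field; lra).
  apply Rmult_lt_compat_l; lra.
Qed.

Lemma debye_phase_0 (x : R) : 0 < x -> debye_phase 0 x = x.
Proof.
  intros Hx. unfold debye_phase.
  replace (x ^ 2 - 0 ^ 2) with (x ^ 2) by ring.
  rewrite sqrt_pow2; lra.
Qed.

(** [F x / x] is the profile at [acos (nu / x)], and both the profile and
    [acos (nu / x)] are nondecreasing. *)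
Lemma debye_phase_superlinear (nu r x : R) : 0 <= nu -> 1 < r -> nu < x ->
  debye_phase nu x <= debye_phase nu (r * x) / r.
Proof.
  intros Hnu Hr Hx. assert (Hrx : x <= r * x) by nra.
  rewrite !debye_phase_polar by lra.
  pose proof (acos_ratio_bounds nu x Hnu Hx).
  pose proof (acos_ratio_bounds nu (r * x) Hnu ltac:(lra)).
  replace (r * x * polar_profile (acos (nu / (r * x))) / r) with
    (x * polar_profile (acos (nu / (r * x)))) by (field; lra).
  apply Rmult_le_compat_l; [lra|].
  destruct (Rle_lt_or_eq_dec 0 nu Hnu) as [h|<-].
  - apply Rlt_le, polar_profile_increasing; try lra.
    pose proof (ratio_bounds nu x Hnu Hx).
    pose proof (ratio_bounds nu (r * x) Hnu ltac:(lra)).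
    destruct (Rlt_dec (acos (nu / x)) (acos (nu / (r * x)))) as [k|k]; [exact k|].
    exfalso.
    pose proof PI_RGT_0.
    assert (k' : cos (acos (nu / x)) <= cos (acos (nu / (r * x)))) by (apply cos_decr_1; lra).
    rewrite !cos_acos in k' by lra.
    assert (nu / (r * x) < nu / x); [|lra].
    apply Rmult_lt_compat_l; [lra|]. apply Rinv_lt_contravar; nra.
  - unfold Rdiv. rewrite !Rmult_0_l. lra.
Qed.

(** * Sturm comparison *)

(** Let [u] be the solution vanishing at [s1].  If [th] grew by at most [PI], then
    [u] would be positive between [s1] and [s2].  The comparison function
    [V = (x^2 - nu^2)^(-1/4) sin (F x - F s1)] is positive there too and vanishes at
    both ends.  The quantity [om = x (u' V - u V')] is then strictly decreasing,
    since [D (D V) + (x^2 - nu^2) V > 0] for [D = x d/dx]; but it is [0] at [s1]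
    and nonnegative at [s2]. *)
Lemma sturm_step nu w u1 v1 u2 v2 th s1 s2 :
  0 <= nu -> positive_pair nu w u1 v1 u2 v2 -> phase_function w u1 u2 th ->
  nu < s1 -> s1 < s2 -> debye_phase nu s2 = debye_phase nu s1 + PI ->
  PI < th s2 - th s1.
Proof.
  intros Hnu HP Hth Hs1 Hs12 HF.
  destruct (Rlt_dec PI (th s2 - th s1)) as [h|h]; [exact h|exfalso].
  assert (Hle : th s2 - th s1 <= PI) by lra. clear h.
  pose proof (square_amplitude_pos _ _ _ _ _ _ HP) as Hm.
  pose proof (phase_formula _ _ _ _ _ _ _ HP Hth) as Hph.
  pose proof (phase_increasing _ _ _ _ _ _ _ HP Hth) as Hinc.
  destruct HP as (H1 & H2 & Hw & HW).
  set (u := fun x => u1 s1 * u2 x - u1 x * u2 s1).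
  set (v := fun x => u1 s1 * v2 x - v1 x * u2 s1).
  assert (Hu0 : forall x, s1 <= x <= s2 -> 0 <= u x).
  { intros x Hx. unfold u. rewrite (Hph s1 x) by lra.
    apply Rmult_le_pos; [apply Rmult_le_pos; apply sqrt_pos|].
    destruct (Req_dec x s1) as [->|hx]; [rewrite Rminus_diag, sin_0; lra|].
    assert (th s1 < th x) by (apply Hinc; lra).
    assert (th x <= th s2).
    { destruct (Req_dec x s2) as [->|hx2]; [lra|]. apply Rlt_le, Hinc; lra. }
    apply sin_ge_0; lra. }
  assert (Hu1 : forall x, s1 < x < s2 -> 0 < u x).
  { intros x Hx. unfold u. rewrite (Hph s1 x) by lra.
    assert (th s1 < th x) by (apply Hinc; lra).
    assert (th x < th s2) by (apply Hinc; lra).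
    apply Rmult_lt_0_compat.
    - apply Rmult_lt_0_compat; apply sqrt_lt_R0; apply Hm; lra.
    - apply sin_gt_0; lra. }
  assert (Hsol : bessel_solution nu u v).
  { intros x Hx. destruct (H1 x Hx) as [Hu1' Hv1'], (H2 x Hx) as [Hu2' Hv2'].
    unfold u, v. split; auto_derive.
    1, 3: repeat split; eexists; eassumption.
    - rewrite (Derive_value _ _ _ Hu1'), (Derive_value _ _ _ Hu2'). field. lra.
    - rewrite (Derive_value _ _ _ Hv1'), (Derive_value _ _ _ Hv2'). field. lra. }
  set (P := fun x => x ^ 2 - nu ^ 2).
  set (phi := fun x => debye_phase nu x - debye_phase nu s1).
  (* [A = P^(-1/4)], the amplitude of the comparison function. *)
  set (A := fun x => exp (- / 4 * ln (P x))).
  set (om := fun x => A x * (v x * sin (phi x) + u x * x ^ 2 / (2 * P x) * sin (phi x)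
                             - u x * sqrt (P x) * cos (phi x))).
  assert (HPpos : forall x, s1 <= x -> 0 < P x) by (intros; unfold P; nra).
  destruct (mean_value om (fun x => - (A x * x * (x ^ 2 / 4 + nu ^ 2) / P x ^ 2) * u x * sin (phi x))
    s1 s2 Hs12) as [t [Ht E]].
  { intros x Hx. assert (Hx0 : 0 < x) by lra.
    destruct (Hsol x Hx0) as [Hu' Hv'].
    pose proof (HPpos x (proj1 Hx)) as HPx.
    assert (HA : is_derive A x (- (x / (2 * P x)) * A x)).
    { unfold A, P in *. auto_derive; [lra|]. 
      replace (x * (x * 1) + - (nu * (nu * 1))) with (x ^ 2 - nu ^ 2) by ring.
      field. lra. }
    assert (Hphi : is_derive phi x (sqrt (P x) / x)).
    { assert (HF' : is_derive (debye_phase nu) x (sqrt (P x) / x))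
        by (apply debye_phase_derive; lra).
      unfold phi. auto_derive; [repeat split; eexists; eassumption|].
      rewrite (Derive_value _ _ _ HF'). ring. }
    assert (HdP : is_derive P x (2 * x)) by (unfold P; auto_derive; [easy|ring]).
    set (S := fun x => sqrt (P x)).
    assert (HdS : is_derive S x (x / sqrt (P x))).
    { evar_last; [apply is_derive_sqrt; [exact HdP|exact HPx]|].
      field. apply Rgt_not_eq, sqrt_lt_R0, HPx. }
    assert (HS : S x * S x = P x) by (apply sqrt_sqrt; lra).
    assert (HS0 : 0 < S x) by (apply sqrt_lt_R0; lra).
    change (sqrt (P x)) with (S x) in *.
    assert (HPx2 : P x = x ^ 2 - nu ^ 2) by reflexivity.
    unfold om. change (fun x => A x * (v x * sin (phi x) + u x * x ^ 2 / (2 * P x) * sin (phi x)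
                             - u x * sqrt (P x) * cos (phi x))) with
      (fun x => A x * (v x * sin (phi x) + u x * x ^ 2 / (2 * P x) * sin (phi x)
                             - u x * S x * cos (phi x))).
    clearbody S phi A P u v.
    auto_derive.
    - repeat split; try (eexists; eassumption). lra.
    - rewrite (Derive_value _ _ _ HA), (Derive_value _ _ _ Hu'), (Derive_value _ _ _ Hv'),
        (Derive_value _ _ _ Hphi), (Derive_value _ _ _ HdS), (Derive_value _ _ _ HdP).
      (* Eliminating [nu] leaves a rational identity in [x] and [S x]. *)
      assert (HS2 : nu ^ 2 = x ^ 2 - S x ^ 2) by (rewrite <- HS in HPx2; lra).
      rewrite HS2, <- HS. field. lra. }
  assert (Eom1 : om s1 = 0).
  { unfold om, phi, u. rewrite Rminus_diag, sin_0. ring. }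
  assert (Eom2 : 0 <= om s2).
  { unfold om, phi. rewrite HF.
    replace (debye_phase nu s1 + PI - debye_phase nu s1) with PI by ring.
    rewrite sin_PI, cos_PI.
    replace (_ + _ - _) with (u s2 * sqrt (P s2)) by ring.
    repeat apply Rmult_le_pos; [apply Rlt_le, exp_pos|apply Hu0; lra|apply sqrt_pos]. }
  assert (0 < A t * t * (t ^ 2 / 4 + nu ^ 2) / P t ^ 2 * u t * sin (phi t) * (s2 - s1)); [|lra].
  repeat apply Rmult_lt_0_compat; try lra.
  - apply exp_pos.
  - nra.
  - apply Rinv_0_lt_compat, pow_lt, HPpos. lra.
  - now apply Hu1.
  - assert (debye_phase nu s1 < debye_phase nu t) by (apply debye_phase_increasing; lra).
    assert (debye_phase nu t < debye_phase nu s2) by (apply debye_phase_increasing; lra).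
    unfold phi. apply sin_gt_0; lra.
Qed.

(** Cutting [x, y] at the points where [F] has grown by multiples of [PI] reduces
    this to single steps.  The inequality becomes strict already in one step. *)
Lemma sturm_comparison nu w u1 v1 u2 v2 th (k : nat) :
  0 <= nu -> positive_pair nu w u1 v1 u2 v2 -> phase_function w u1 u2 th ->
  forall x y, nu < x -> nu < y ->
  INR (S k) * PI <= debye_phase nu y - debye_phase nu x ->
  INR (S k) * PI < th y - th x.
Proof.
  intros Hnu HP Hth. pose proof PI_RGT_0 as Hpi.
  pose proof (phase_increasing _ _ _ _ _ _ _ HP Hth) as Hinc.
  induction k as [|k IH]; intros x y Hx Hy HF.
  all: assert (0 < INR 1 * PI) by (simpl; lra).
  2: assert (Hk : 0 < INR (S k)) by (apply lt_0_INR; lia).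
  2: rewrite (S_INR (S k)) in *.
  1: change (INR 1) with 1 in *.
  all: assert (Hxy : x < y) by
   (destruct (Rlt_dec x y) as [h|h]; [exact h|exfalso];
    destruct (Req_dec y x) as [->|hne]; [nra|];
    pose proof (debye_phase_increasing nu y x Hnu Hy ltac:(lra)); nra).
  - destruct (Req_dec (debye_phase nu y) (debye_phase nu x + PI)) as [e|hne].
    + pose proof (sturm_step nu w u1 v1 u2 v2 th x y Hnu HP Hth Hx Hxy e). lra.
    + destruct (intermediate_value (debye_phase nu) x y (debye_phase nu x + PI) Hxy)
        as [s [Hs E]]; [| lra |].
      * intros t Ht. eexists. apply debye_phase_derive; lra.
      * pose proof (sturm_step nu w u1 v1 u2 v2 th x s Hnu HP Hth Hx (proj1 Hs) E).
        pose proof (Hinc s y ltac:(lra) (proj2 Hs)). lra.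
  - destruct (intermediate_value (debye_phase nu) x y (debye_phase nu x + PI) Hxy)
        as [s [Hs E]]; [| nra |].
    + intros t Ht. eexists. apply debye_phase_derive; lra.
    + pose proof (sturm_step nu w u1 v1 u2 v2 th x s Hnu HP Hth Hx (proj1 Hs) E).
      specialize (IH s y ltac:(lra) Hy ltac:(lra)). lra.
Qed.

(** * Zeros of the cross product of two solutions *)

(** This chooses the constant in the theorem: since [r B - PI nu / 2] equals
    [r k PI / (r - 1)], the bounds on [F] yield
    [F (r B) - F B >= (1 - 1/r) F (r B) >= k PI].  When [B <= nu] the Debye phase is
    unavailable at [B]; but then [nu > 0], the last inequality is strict, and a
    point [b] slightly above [nu] serves, because [F b] is small. *)
Lemma debye_phase_increment (nu r : R) (k : nat) :
  0 <= nu -> 1 < r -> (1 <= k)%nat ->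
  let B := PI * INR k / (r - 1) + PI * nu / (2 * r) in
  exists b, nu < b /\ B <= b /\ nu < r * B /\ INR k * PI <= debye_phase nu (r * B) - debye_phase nu b.
Proof.
  intros Hnu Hr Hk B. pose proof PI_RGT_0 as Hpi.
  assert (Hk1 : 1 <= INR k) by (change 1 with (INR 1); now apply le_INR).
  assert (HB0 : 0 < PI * INR k / (r - 1)) by (apply Rdiv_lt_0_compat; nra).
  assert (HB1 : PI * nu / (2 * r) = PI * nu / 2 / r) by (field; lra).
  assert (HB2 : 0 <= PI * nu / 2 / r) by (apply Rdiv_le_0_compat; nra).
  assert (HB : r * B - PI * nu / 2 = r * (PI * INR k / (r - 1))) by (unfold B; field; lra).
  assert (HB' : (1 - / r) * (r * (PI * INR k / (r - 1))) = INR k * PI) by (field; lra).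
  assert (HnuB : nu < r * B).
  { assert (0 < r * (PI * INR k / (r - 1))) by nra.
    pose proof PI2_1. nra. }
  assert (Hri : 0 < / r < 1).
  { split; [apply Rinv_0_lt_compat; lra|]. rewrite <- Rinv_1.
    apply Rinv_lt_contravar; lra. }
  destruct (Rle_lt_or_eq_dec 0 nu Hnu) as [Hnu0|<-].
  - pose proof (debye_phase_lower nu (r * B) Hnu0 HnuB) as HL.
    set (FR := debye_phase nu (r * B)) in *.
    assert (Hmain : INR k * PI < (1 - / r) * FR).
    { rewrite <- HB'. apply Rmult_lt_compat_l; lra. }
    destruct (Rlt_dec nu B) as [h|h].
    + exists B. repeat split; try lra.
      pose proof (debye_phase_superlinear nu r B Hnu Hr h) as Hs. fold FR in Hs.
      unfold Rdiv in Hs. lra.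
    + assert (HFR : 0 < FR) by nra.
      set (e := FR - INR k * PI).
      assert (He : 0 < e) by (unfold e; nra).
      assert (Hb : nu < sqrt (nu ^ 2 + e ^ 2)).
      { rewrite <- (sqrt_pow2 nu) at 1 by lra. apply sqrt_lt_1; nra. }
      (* Here [F b <= sqrt (b^2 - nu^2) = e]. *)
      exists (sqrt (nu ^ 2 + e ^ 2)). repeat split; try lra.
      assert (debye_phase nu (sqrt (nu ^ 2 + e ^ 2)) <= e); [|unfold e in *; lra].
      unfold debye_phase. rewrite pow2_sqrt by nra.
      replace (nu ^ 2 + e ^ 2 - nu ^ 2) with (e ^ 2) by ring.
      rewrite sqrt_pow2 by lra.
      pose proof (acos_bound (nu / sqrt (nu ^ 2 + e ^ 2))). nra.
  - assert (EB : B = PI * INR k / (r - 1)) by (unfold B; field; lra).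
    exists B. rewrite !debye_phase_0 by lra. repeat split; try lra.
    rewrite EB. apply Req_le. field. lra.
Qed.

(** Points chosen at different levels are automatically distinct. *)
Lemma distinct_level_points (f : R -> R) (c z0 B : R) (k : nat) :
  z0 < B -> 0 < c -> (forall z, z0 <= z <= B -> ex_derive f z) ->
  f z0 < c -> INR k * c < f B ->
  exists l, NoDup l /\ length l = k /\
    forall z, In z l -> z0 < z < B /\ exists i, f z = INR i * c.
Proof.
  intros HzB Hc Hf Hz0 HB.
  cut (forall j, (j <= k)%nat -> exists l, NoDup l /\ length l = j /\
    forall z, In z l -> z0 < z < B /\ exists i, (i <= j)%nat /\ f z = INR i * c).
  { intros H. destruct (H k (Nat.le_refl k)) as [l [H1 [H2 H3]]].
    exists l. split; [exact H1|]. split; [exact H2|]. intros z Hz.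
    destruct (H3 z Hz) as [h [i [_ hi]]]. split; [exact h|now exists i]. }
  induction j as [|j IH]; intros Hj.
  - exists nil. repeat split; [constructor|..]; easy.
  - destruct IH as [l [H1 [H2 H3]]]; [lia|].
    assert (Hjk : INR (S j) <= INR k) by now apply le_INR.
    rewrite S_INR in Hjk. pose proof (pos_INR j).
    destruct (intermediate_value f z0 B (INR (S j) * c) HzB Hf) as [z [Hz E]].
    { rewrite S_INR. split; nra. }
    exists (z :: l). split; [|split].
    + constructor; [|exact H1]. intros Hin.
      destruct (H3 z Hin) as [_ [i [Hi Ei]]]. rewrite E in Ei.
      apply Rmult_eq_reg_r in Ei; [|lra]. apply INR_eq in Ei. lia.
    + simpl. now rewrite H2.
    + intros y [<-|Hin].
      * split; [exact Hz|]. now exists (S j).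
      * destruct (H3 y Hin) as [Hy [i [Hi Ei]]]. split; [exact Hy|]. exists i. auto.
Qed.

(** [Phi z = th (r z) - th z] goes from below [PI] near [0] to above [k PI] at the
    bound, and each level [i PI] in between is a zero of the cross product. *)
Lemma many_cross_zeros nu w u1 v1 u2 v2 del r k :
  0 <= nu -> positive_pair nu w u1 v1 u2 v2 ->
  0 < del -> (forall t, 0 < t < del -> 0 < u1 t) ->
  1 < r -> (1 <= k)%nat ->
  exists l, NoDup l /\ length l = k /\ forall z, In z l ->
    0 < z < PI * INR k / (r - 1) + PI * nu / (2 * r) /\
    u1 (r * z) * u2 z - u1 z * u2 (r * z) = 0.
Proof.
  intros Hnu HP Hdel Hu1 Hr Hk. pose proof PI_RGT_0 as Hpi.
  destruct (phase_function_exists _ _ _ _ _ _ HP) as [th Hth].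
  destruct (debye_phase_increment nu r k Hnu Hr Hk) as [b [Hb1 [Hb2 [Hb3 Hb4]]]].
  set (B := PI * INR k / (r - 1) + PI * nu / (2 * r)) in *.
  assert (HB : 0 < B) by nra.
  set (Phi := fun z => th (r * z) - th z).
  assert (HPhiB : INR k * PI < Phi B).
  { destruct k as [|k]; [lia|].
    pose proof (sturm_comparison _ _ _ _ _ _ _ k Hnu HP Hth b (r * B) Hb1 Hb3 Hb4) as H.
    assert (th B <= th b).
    { destruct (Req_dec B b) as [<-|h]; [lra|].
      apply Rlt_le, (phase_increasing _ _ _ _ _ _ _ HP Hth); lra. }
    unfold Phi. lra. }
  (* Small enough for [u1] to be positive on [z0, r z0]. *)
  set (z0 := Rmin (B / 2) (del / (2 * r))).
  assert (Hd : 0 < del / (2 * r)) by (apply Rdiv_lt_0_compat; lra).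
  assert (Hz0 : 0 < z0 /\ z0 < B /\ z0 <= del / (2 * r)).
  { unfold z0, Rmin. destruct Rle_dec; lra. }
  assert (Hrz0 : r * z0 < del).
  { assert (r * (del / (2 * r)) = del / 2) by (field; lra). nra. }
  assert (HPhi0 : Phi z0 < PI).
  { apply (phase_increment_lt_PI _ _ _ _ _ _ _ HP Hth); try nra.
    intros t Ht. apply Hu1. nra. }
  destruct (distinct_level_points Phi PI z0 B k) as [l [H1 [H2 H3]]]; try lra.
  - intros z Hz.
    assert (e1 : ex_derive th (r * z)) by (eexists; apply Hth; nra).
    assert (e2 : ex_derive th z) by (eexists; apply Hth; lra).
    unfold Phi. auto_derive. auto.
  - exists l. split; [exact H1|]. split; [exact H2|]. intros z Hz.
    destruct (H3 z Hz) as [Hz' [i Ei]]. split; [lra|].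
    assert (Hz0' : 0 < z) by lra.
    transitivity (- (u1 z * u2 (r * z) - u1 (r * z) * u2 z)); [ring|].
    rewrite (phase_formula _ _ _ _ _ _ _ HP Hth z (r * z)); [|lra|nra].
    fold (Phi z). rewrite Ei, INR_IZR_INZ.
    rewrite sin_eq_0_1; [ring|]. now exists (Z.of_nat i).
Qed.

(** * Entire power series and Frobenius solutions *)

Definition entire (e : nat -> R) : Prop := CV_radius e = p_infty.

Lemma entire_of_bounded (e : nat -> R) :
  (forall r, exists M, forall n, Rabs (e n * r ^ n) <= M) -> entire e.
Proof.
  intros H. unfold entire. destruct (CV_radius_bounded e) as [Hub _].
  destruct (CV_radius e) as [c| |]; [exfalso|reflexivity|exfalso].
  - specialize (Hub (c + 1) (H (c + 1))). simpl in Hub. lra.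
  - specialize (Hub 0 (H 0)). simpl in Hub. easy.
Qed.

Lemma bounded_of_eventually_decreasing (N : nat) (u : nat -> R) :
  (forall n, 0 <= u n) ->
  (forall n, (N <= n)%nat -> u (S n) <= u n) -> exists M, forall n, u n <= M.
Proof.
  revert u. induction N as [|N IH]; intros u Hpos Hu.
  - exists (u 0%nat). induction n as [|n IHn]; [lra|].
    specialize (Hu n ltac:(lia)). lra.
  - destruct (IH (fun n => u (S n))) as [M HM].
    + auto.
    + intros n Hn. apply Hu. lia.
    + exists (Rmax (u 0%nat) M). intros [|n].
      * apply Rmax_l.
      * eapply Rle_trans; [apply HM|apply Rmax_r].
Qed.

(** Recurrences for coefficients give exactly this kind of ratio bound; unlike the
    ratio test it allows coefficients that vanish. *)
Lemma entire_of_ratio (e : nat -> R) (N : nat) (K : R) :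
  (forall m, (N <= m)%nat -> INR (S m) * Rabs (e (S m)) <= K * Rabs (e m)) ->
  entire e.
Proof.
  intros H. apply entire_of_bounded. intros r.
  destruct (nfloor_ex (Rabs (K * r)) (Rabs_pos _)) as [N2 HN2].
  destruct (bounded_of_eventually_decreasing (N + S N2) (fun n => Rabs (e n * r ^ n)))
    as [M HM].
  - intros. apply Rabs_pos.
  - intros n Hn. specialize (H n ltac:(lia)).
    rewrite !Rabs_mult. simpl pow. rewrite Rabs_mult.
    assert (Hn1 : Rabs (K * r) <= INR (S n)).
    { apply Rle_trans with (INR N2 + 1); [lra|]. rewrite <- S_INR. apply le_INR. lia. }
    assert (Hn0 : 0 < INR (S n)) by (apply lt_0_INR; lia).
    rewrite Rabs_mult in Hn1.
    pose proof (Rabs_pos r). pose proof (Rabs_pos (r ^ n)).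
    pose proof (Rabs_pos (e n)). pose proof (Rle_abs K).
    apply Rmult_le_reg_l with (INR (S n)); [exact Hn0|].
    apply Rle_trans with (Rabs K * Rabs (e n) * (Rabs r * Rabs (r ^ n))).
    + replace (INR (S n) * (Rabs (e (S n)) * (Rabs r * Rabs (r ^ n)))) with
        ((INR (S n) * Rabs (e (S n))) * (Rabs r * Rabs (r ^ n))) by ring.
      apply Rmult_le_compat_r; [nra|].
      apply Rle_trans with (1 := H). apply Rmult_le_compat_r; lra.
    + replace (Rabs K * Rabs (e n) * (Rabs r * Rabs (r ^ n))) with
        ((Rabs K * Rabs r) * (Rabs (e n) * Rabs (r ^ n))) by ring.
      apply Rmult_le_compat_r; [nra|exact Hn1].
  - now exists M.
Qed.

Lemma entire_of_le (a b : nat -> R) :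
  entire b -> (forall m, Rabs (a m) <= b m) -> entire a.
Proof.
  intros Hb Hab. apply entire_of_bounded. intros r.
  assert (Hs : ex_series (fun n => Rabs (b n * r ^ n))).
  { apply CV_disk_inside. rewrite Hb. easy. }
  apply ex_series_lim_0 in Hs.
  destruct (filterlim_bounded (fun n => Rabs (b n * r ^ n))) as [M HM].
  { exists 0. exact Hs. }
  exists M. intros n. specialize (HM n). eapply Rle_trans; [|exact HM].
  unfold norm; simpl; unfold abs; simpl. rewrite Rabs_Rabsolu, !Rabs_mult.
  apply Rmult_le_compat_r; [apply Rabs_pos|].
  eapply Rle_trans; [apply Hab|apply Rle_abs].
Qed.

Lemma entire_disk (e : nat -> R) (x : R) : entire e -> Rbar_lt (Rabs x) (CV_radius e).
Proof. intros ->. easy. Qed.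

Lemma entire_derive (e : nat -> R) : entire e -> entire (PS_derive e).
Proof. unfold entire. now rewrite CV_radius_derive. Qed.

Definition frobenius (s : R) (e : nat -> R) (x : R) : R :=
  Rpower (x / 2) s * PSeries e ((x / 2) ^ 2).

(** [x] times the derivative of the Frobenius series. *)
Definition frobenius_D (s : R) (e : nat -> R) (x : R) : R :=
  Rpower (x / 2) s * (s * PSeries e ((x / 2) ^ 2)
    + 2 * (x / 2) ^ 2 * PSeries (PS_derive e) ((x / 2) ^ 2)).

(** Bessel's operator acts on the coefficients of [(x/2)^s sum e_m (x/2)^(2m)] as this
    two-term recurrence, so its vanishing makes the series a solution. *)
Definition frobenius_operator (s : R) (e : nat -> R) (m : nat) : R :=
  INR (S m) * (INR (S m) + s) * e (S m) + e m.

Lemma PSeries_frobenius_operator (s : R) (e : nat -> R) (q : R) : entire e ->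
  PSeries (frobenius_operator s e) q =
  q * PSeries (PS_derive (PS_derive e)) q + (s + 1) * PSeries (PS_derive e) q
  + PSeries e q.
Proof.
  intros He.
  assert (He1 := entire_derive _ He). assert (He2 := entire_derive _ He1).
  assert (Hex : forall a, entire a -> ex_pseries a q).
  { intros a Ha. apply CV_radius_inside, entire_disk, Ha. }
  rewrite <- PSeries_incr_1, <- PSeries_scal.
  rewrite <- PSeries_plus, <- PSeries_plus.
  - apply PSeries_ext. intros [|m]; unfold frobenius_operator, PS_plus, PS_scal,
      PS_incr_1, PS_derive; cbn -[INR]; unfold plus, scal, mult, zero; cbn -[INR];
      unfold mult; cbn -[INR].
    + simpl INR. ring.
    + rewrite (S_INR (S m)). ring.
  - apply ex_pseries_plus; [|].
    + apply ex_pseries_incr_1. auto.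
    + apply ex_pseries_scal; [apply Rmult_comm|auto].
  - auto.
  - apply ex_pseries_incr_1. auto.
  - apply ex_pseries_scal; [apply Rmult_comm|auto].
Qed.

Lemma Rpower_half_derive (s x : R) : 0 < x ->
  is_derive (fun x => Rpower (x / 2) s) x (Rpower (x / 2) s * s / x).
Proof.
  intros Hx. unfold Rpower. auto_derive; [lra|]. unfold Rdiv. field. lra.
Qed.

Lemma PSeries_half_square_derive (e : nat -> R) (x : R) : entire e ->
  is_derive (fun x => PSeries e ((x / 2) ^ 2)) x
    (PSeries (PS_derive e) ((x / 2) ^ 2) * (x / 2)).
Proof.
  intros He.
  evar_last.
  - apply (is_derive_comp (PSeries e) (fun x => (x / 2) ^ 2)).
    + apply is_derive_PSeries, entire_disk, He.
    + auto_derive; [easy|reflexivity].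
  - unfold scal; simpl; unfold mult; simpl. field.
Qed.

Lemma frobenius_derive (s : R) (e : nat -> R) (x : R) : entire e -> 0 < x ->
  is_derive (frobenius s e) x (frobenius_D s e x / x).
Proof.
  intros He Hx.
  pose proof (Rpower_half_derive s x Hx) as HR.
  pose proof (PSeries_half_square_derive e x He) as HP.
  unfold frobenius, frobenius_D.
  evar_last.
  - apply (is_derive_mult (fun x => Rpower (x / 2) s) (fun x => PSeries e ((x / 2) ^ 2)));
      [exact HR|exact HP|apply Rmult_comm].
  - unfold plus, mult; simpl. field. lra.
Qed.

(** For arbitrary coefficients there is a remainder; the logarithmic solution needs
    this inhomogeneous form. *)
Lemma frobenius_D_derive (s : R) (e : nat -> R) (x : R) : entire e -> 0 < x ->
  is_derive (frobenius_D s e) x (- ((x ^ 2 - s ^ 2) / x) * frobenius s e x +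
    Rpower (x / 2) s * x * PSeries (frobenius_operator s e) ((x / 2) ^ 2)).
Proof.
  intros He Hx.
  pose proof (Rpower_half_derive s x Hx) as HR.
  pose proof (PSeries_half_square_derive e x He) as HP.
  pose proof (PSeries_half_square_derive _ x (entire_derive e He)) as HP1.
  rewrite (PSeries_frobenius_operator s e _ He).
  unfold frobenius, frobenius_D.
  set (f := fun x => Rpower (x / 2) s) in *.
  set (S0 := fun x => PSeries e ((x / 2) ^ 2)) in *.
  set (S1 := fun x => PSeries (PS_derive e) ((x / 2) ^ 2)) in *.
  change (Rpower (x / 2) s) with (f x) in *.
  change (PSeries e ((x / 2) ^ 2)) with (S0 x) in *.
  change (PSeries (PS_derive e) ((x / 2) ^ 2)) with (S1 x) in *.
  change (is_derive (fun x => f x * (s * S0 x + 2 * (x / 2) ^ 2 * S1 x)) x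
    (- ((x ^ 2 - s ^ 2) / x) * (f x * S0 x) +
    f x * x * ((x / 2) ^ 2 * PSeries (PS_derive (PS_derive e)) ((x / 2) ^ 2)
      + (s + 1) * S1 x + S0 x))).
  change (is_derive f x (f x * s / x)) in HR.
  change (is_derive S0 x (S1 x * (x / 2))) in HP.
  change (is_derive S1 x (PSeries (PS_derive (PS_derive e)) ((x / 2) ^ 2) * (x / 2))) in HP1.
  clearbody f S0 S1.
  auto_derive.
  - repeat split; eexists; eassumption.
  - rewrite (Derive_value _ _ _ HR), (Derive_value _ _ _ HP), (Derive_value _ _ _ HP1).
    field. lra.
Qed.

Lemma frobenius_solution (s : R) (e : nat -> R) : entire e ->
  (forall m, frobenius_operator s e m = 0) ->
  bessel_solution s (frobenius s e) (frobenius_D s e).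
Proof.
  intros He H0 x Hx. split; [now apply frobenius_derive|].
  evar_last; [now apply frobenius_D_derive|].
  rewrite (PSeries_ext _ (fun _ => 0)), PSeries_const_0 by exact H0. ring.
Qed.
Lemma bessel_solution_opp (s : R) u v : bessel_solution (- s) u v -> bessel_solution s u v.
Proof.
  intros H x Hx. replace (s ^ 2) with ((- s) ^ 2) by ring. now apply H.
Qed.

Lemma half_square_lim :
  filterlim (fun x => (x / 2) ^ 2) (at_right 0) (locally 0).
Proof.
  assert (H : continuous (fun x => (x / 2) ^ 2) 0).
  { apply (ex_derive_continuous (fun x => (x / 2) ^ 2)). auto_derive. easy. }
  unfold continuous in H. replace ((0 / 2) ^ 2) with 0 in H by field.
  eapply filterlim_filter_le_1; [apply filter_le_within|exact H].
Qed.

(** Used to evaluate Wronskians: they are constant, and although the solutions are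
    singular at [0], the powers of [x/2] cancel and leave a continuous function. *)
Lemma constant_value_at_0 (w g : R -> R) :
  (forall x y, 0 < x -> 0 < y -> w x = w y) ->
  (forall x, 0 < x -> w x = g ((x / 2) ^ 2)) -> continuous g 0 ->
  forall x, 0 < x -> w x = g 0.
Proof.
  intros Hw Hg Hc x Hx.
  apply (filterlim_locally_unique (F := at_right 0) w).
  - apply filterlim_ext_loc with (fun _ => w x); [|apply filterlim_const].
    exists (mkposreal 1 Rlt_0_1). intros y _ Hy. now apply Hw.
  - apply filterlim_ext_loc with (fun x => g ((x / 2) ^ 2)).
    + exists (mkposreal 1 Rlt_0_1). intros y _ Hy. symmetry. now apply Hg.
    + eapply filterlim_comp; [apply half_square_lim|exact Hc].
Qed.

Lemma PSeries_continuous_entire (e : nat -> R) (x : R) : entire e -> continuous (PSeries e) x.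
Proof. intros He. apply (ex_derive_continuous (PSeries e)), ex_derive_PSeries, entire_disk, He. Qed.

Lemma frobenius_positive (s : R) (e : nat -> R) : entire e -> 0 < e 0%nat ->
  exists del, 0 < del /\ forall x, 0 < x < del -> 0 < frobenius s e x.
Proof.
  intros He H0.
  pose proof (PSeries_continuous_entire e 0 He) as Hc.
  assert (Hl : filterlim (fun x => PSeries e ((x / 2) ^ 2)) (at_right 0) (locally (e 0%nat))).
  { rewrite <- PSeries_0. eapply filterlim_comp; [apply half_square_lim|exact Hc]. }
  destruct (Hl (fun y => 0 < y) (open_gt 0 _ H0)) as [d Hd].
  exists d. split; [apply cond_pos|]. intros x Hx.
  apply Rmult_lt_0_compat; [apply exp_pos|]. apply Hd; [|lra].
  unfold ball; simpl; unfold AbsRing_ball, abs, minus, plus, opp; simpl.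
  rewrite Ropp_0, Rplus_0_r, Rabs_pos_eq; lra.
Qed.

Lemma Rpower_half_opp (s x : R) : Rpower (x / 2) s * Rpower (x / 2) (- s) = 1.
Proof. rewrite <- Rpower_plus, Rplus_opp_r. unfold Rpower. rewrite Rmult_0_l. apply exp_0. Qed.

(** The powers [(x/2)^s] and [(x/2)^(-s)] cancel in the Wronskian, so it can be read off at [0]. *)
Lemma frobenius_wronskian (s : R) (a b : nat -> R) : entire a -> entire b ->
  (forall m, frobenius_operator s a m = 0) ->
  (forall m, frobenius_operator (- s) b m = 0) ->
  forall x, 0 < x ->
  wronskian (frobenius s a) (frobenius_D s a) (frobenius (- s) b) (frobenius_D (- s) b) x
  = - 2 * s * a 0%nat * b 0%nat.
Proof.
  intros Ha Hb Ha0 Hb0.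
  set (g := fun q => - 2 * s * PSeries a q * PSeries b q +
    2 * q * (PSeries a q * PSeries (PS_derive b) q - PSeries (PS_derive a) q * PSeries b q)).
  replace (- 2 * s * a 0%nat * b 0%nat) with (g 0) by (unfold g; rewrite !PSeries_0; ring).
  apply constant_value_at_0.
  - apply (wronskian_constant s).
    + now apply frobenius_solution.
    + now apply bessel_solution_opp, frobenius_solution.
  - intros x Hx. unfold wronskian, frobenius, frobenius_D, g.
    pose proof (Rpower_half_opp s x) as HR.
    set (A := Rpower (x / 2) s) in *. set (B := Rpower (x / 2) (- s)) in *.
    transitivity ((A * B) * (- 2 * s * PSeries a ((x / 2) ^ 2) * PSeries b ((x / 2) ^ 2) +
     2 * (x / 2) ^ 2 * (PSeries a ((x / 2) ^ 2) * PSeries (PS_derive b) ((x / 2) ^ 2)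
        - PSeries (PS_derive a) ((x / 2) ^ 2) * PSeries b ((x / 2) ^ 2)))); [ring|].
    rewrite HR. ring.
  - apply (ex_derive_continuous g). unfold g.
    assert (E : forall e, entire e -> ex_derive (PSeries e) 0)
      by (intros; now apply ex_derive_PSeries, entire_disk).
    auto_derive. repeat split; apply E; repeat apply entire_derive; assumption.
Qed.

(** * The reciprocal gamma function *)

(** The sequence in Gauss's limit for [1 / Gamma x]. *)
Definition gauss_product (x : R) (n : nat) : R :=
  prod_f_R0 (fun k => x + INR k) n / (INR (fact n) * Rpower (INR n) x).

Lemma exp_le_compat (x y : R) : x <= y -> exp x <= exp y.
Proof.
  intros [h| ->]; [now apply Rlt_le, exp_increasing|apply Rle_refl].
Qed.

Lemma ln_le_sub_1 (y : R) : 0 < y -> ln y <= y - 1.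
Proof.
  intros Hy. pose proof (exp_ineq1_le (ln y)) as H. rewrite exp_ln in H; lra.
Qed.

Lemma ln_succ_sub_lower (a : R) : 0 < a -> / (a + 1) <= ln (a + 1) - ln a.
Proof.
  intros Ha.
  pose proof (ln_le_sub_1 (a / (a + 1)) ltac:(apply Rdiv_lt_0_compat; lra)) as H.
  rewrite ln_div in H by lra.
  replace (a / (a + 1) - 1) with (- / (a + 1)) in H by (field; lra). lra.
Qed.

Lemma ln_succ_sub_upper (a : R) : 0 < a -> ln (a + 1) - ln a <= / a.
Proof.
  intros Ha.
  pose proof (ln_le_sub_1 ((a + 1) / a) ltac:(apply Rdiv_lt_0_compat; lra)) as H.
  rewrite ln_div in H by lra.
  replace ((a + 1) / a - 1) with (/ a) in H by (field; lra). lra.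
Qed.

Lemma Rpower_succ (a x : R) :
  Rpower (a + 1) x = Rpower a x * exp (x * (ln (a + 1) - ln a)).
Proof. unfold Rpower. rewrite <- exp_plus. f_equal. ring. Qed.

Lemma Rpower_pos (a x : R) : 0 < Rpower a x.
Proof. apply exp_pos. Qed.

Lemma fact_S_INR (n : nat) : INR (fact (S n)) = (INR n + 1) * INR (fact n).
Proof. rewrite fact_simpl, mult_INR, S_INR. reflexivity. Qed.

Lemma prod_shift (x : R) (n : nat) :
  prod_f_R0 (fun k => x + INR k) n * (x + INR n + 1) =
  x * prod_f_R0 (fun k => x + 1 + INR k) n.
Proof.
  induction n as [|n IH].
  - simpl. ring.
  - cbn [prod_f_R0]. rewrite S_INR.
    rewrite <- Rmult_assoc, <- IH. ring.
Qed.

Lemma gauss_product_shift (x : R) (n : nat) : (1 <= n)%nat -> x + INR n + 1 <> 0 ->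
  gauss_product x n = x * gauss_product (x + 1) n * (INR n / (x + INR n + 1)).
Proof.
  intros Hn Hx. assert (0 < INR n) by (apply lt_0_INR; lia).
  pose proof (prod_shift x n) as E. unfold gauss_product.
  rewrite Rpower_plus, Rpower_1 by easy.
  pose proof (INR_fact_lt_0 n). pose proof (Rpower_pos (INR n) x).
  replace (prod_f_R0 (fun k => x + INR k) n) with
    (x * prod_f_R0 (fun k => x + 1 + INR k) n / (x + INR n + 1))
    by (rewrite <- E; field; easy).
  field. repeat split; lra.
Qed.

Lemma prod_nonneg (x : R) (n : nat) : 0 <= x -> 0 <= prod_f_R0 (fun k => x + INR k) n.
Proof.
  intros Hx. induction n as [|n IH]; cbn [prod_f_R0].
  - simpl. lra.
  - apply Rmult_le_pos; [exact IH|]. pose proof (pos_INR (S n)). lra.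
Qed.

Lemma gauss_product_nonneg (x : R) (n : nat) : 0 <= x -> 0 <= gauss_product x n.
Proof.
  intros Hx. apply Rdiv_le_0_compat; [now apply prod_nonneg|].
  apply Rmult_lt_0_compat; [apply INR_fact_lt_0|apply Rpower_pos].
Qed.

(** The ratio of consecutive terms is [(1 + x/N) (1 - 1/N)^x] with [N = n + 1], and
    [1 + t <= exp t] is used twice. *)
Lemma gauss_product_decreasing (x : R) (n : nat) : 0 <= x -> (1 <= n)%nat ->
  gauss_product x (S n) <= gauss_product x n.
Proof.
  intros Hx Hn. assert (Hn0 : 0 < INR n) by (apply lt_0_INR; lia).
  unfold gauss_product. cbn [prod_f_R0]. rewrite fact_S_INR, !S_INR, Rpower_succ.
  pose proof (prod_nonneg x n Hx) as Hp.
  pose proof (INR_fact_lt_0 n) as Hf. pose proof (Rpower_pos (INR n) x) as HR.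
  set (p := prod_f_R0 _ n) in *. set (f := INR (fact n)) in *.
  set (a := INR n) in *. set (P := Rpower a x) in *.
  set (E := exp (x * (ln (a + 1) - ln a))).
  assert (HE : 1 + x / (a + 1) <= E).
  { eapply Rle_trans; [apply exp_ineq1_le|]. apply exp_le_compat.
    apply Rmult_le_compat_l; [lra|]. now apply ln_succ_sub_lower. }
  assert (HE0 : 0 < E) by apply exp_pos.
  replace (p * (x + (a + 1)) / ((a + 1) * f * (P * E))) with
    (p / (f * P) * ((1 + x / (a + 1)) / E)) by (field; repeat split; lra).
  rewrite <- (Rmult_1_r (p / (f * P))) at 2.
  apply Rmult_le_compat_l.
  - apply Rdiv_le_0_compat; [lra|]. apply Rmult_lt_0_compat; lra.
  - apply Rmult_le_reg_r with E; [exact HE0|]. unfold Rdiv at 1.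
    rewrite Rmult_assoc, Rinv_l by lra. lra.
Qed.

Lemma gauss_product_cv_nonneg (x : R) : 0 <= x -> ex_finite_lim_seq (gauss_product x).
Proof.
  intros Hx. destruct (ex_finite_lim_seq_decr (fun n => gauss_product x (S n)) 0) as [l Hl].
  - intros n. apply gauss_product_decreasing; [exact Hx|lia].
  - intros n. now apply gauss_product_nonneg.
  - exists l. now apply is_lim_seq_incr_1.
Qed.

Lemma is_lim_seq_ratio (x : R) :
  is_lim_seq (fun n => INR n / (x + INR n + 1)) 1.
Proof.
  apply is_lim_seq_ext_loc with (fun n => 1 - (x + 1) * / (INR n + (x + 1))).
  - destruct (nfloor_ex (Rabs (x + 1)) (Rabs_pos _)) as [N HN].
    exists (S N). intros n Hn.
    assert (INR (S N) <= INR n) by now apply le_INR. rewrite S_INR in H.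
    pose proof (Rle_abs (- (x + 1))). rewrite Rabs_Ropp in H0. field. lra.
  - replace (Finite 1) with (Finite (1 - (x + 1) * 0)) by (f_equal; ring).
    apply is_lim_seq_minus'; [apply is_lim_seq_const|].
    apply is_lim_seq_mult'; [apply is_lim_seq_const|].
    evar_last; [apply is_lim_seq_inv|].
    + eapply is_lim_seq_plus; [apply is_lim_seq_INR|apply is_lim_seq_const|].
      reflexivity.
    + easy.
    + reflexivity.
Qed.

Lemma gauss_product_lim_shift (x l : R) :
  is_lim_seq (gauss_product (x + 1)) l -> is_lim_seq (gauss_product x) (x * l).
Proof.
  intros H.
  apply is_lim_seq_ext_loc with
    (fun n => x * gauss_product (x + 1) n * (INR n / (x + INR n + 1))).
  - destruct (nfloor_ex (Rabs (x + 1)) (Rabs_pos _)) as [N HN].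
    exists (S N). intros n Hn. symmetry. apply gauss_product_shift; [lia|].
    assert (INR (S N) <= INR n) by now apply le_INR. rewrite S_INR in H0.
    pose proof (Rle_abs (- (x + 1))). rewrite Rabs_Ropp in H1. lra.
  - replace (Finite (x * l)) with (Finite (x * l * 1)) by (f_equal; ring).
    apply is_lim_seq_mult'; [|apply is_lim_seq_ratio].
    apply is_lim_seq_mult'; [apply is_lim_seq_const|exact H].
Qed.

(** Monotone for [x >= 0]; the shift by [1] then carries convergence to the left. *)
Lemma rgamma_is_lim (x : R) : is_lim_seq (gauss_product x) (rgamma x).
Proof.
  assert (H : forall N x, - INR N <= x -> ex_finite_lim_seq (gauss_product x)).
  { induction N as [|N IH]; intros y Hy.
    - apply gauss_product_cv_nonneg. simpl in Hy. lra.
    - rewrite S_INR in Hy. destruct (IH (y + 1) ltac:(lra)) as [l Hl].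
      exists (y * l). now apply gauss_product_lim_shift. }
  destruct (nfloor_ex (Rabs x) (Rabs_pos _)) as [N HN].
  destruct (H (S N) x) as [l Hl].
  - rewrite S_INR. pose proof (Rle_abs (- x)). rewrite Rabs_Ropp in H0. lra.
  - unfold rgamma. change (is_lim_seq (gauss_product x) (real (Lim_seq (gauss_product x)))).
    now rewrite (is_lim_seq_unique _ _ Hl).
Qed.

Lemma rgamma_shift (x : R) : rgamma x = x * rgamma (x + 1).
Proof.
  pose proof (gauss_product_lim_shift x _ (rgamma_is_lim (x + 1))) as H.
  apply is_lim_seq_unique in H.
  pose proof (is_lim_seq_unique _ _ (rgamma_is_lim x)) as H'.
  rewrite H in H'. now injection H'.
Qed.

(** The tangent to [exp] at [x t], evaluated at [0] and [t] and averaged with the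
    weights [1 - x] and [x]. *)
Lemma exp_convex (x t : R) : 0 <= x <= 1 -> exp (x * t) <= 1 - x + x * exp t.
Proof.
  intros Hx.
  assert (H1 : exp (x * t) * (1 + - (x * t)) <= 1).
  { apply Rle_trans with (exp (x * t) * exp (- (x * t))).
    - apply Rmult_le_compat_l; [apply Rlt_le, exp_pos|apply exp_ineq1_le].
    - rewrite <- exp_plus, Rplus_opp_r, exp_0. lra. }
  assert (H2 : exp (x * t) * (1 + (t - x * t)) <= exp t).
  { apply Rle_trans with (exp (x * t) * exp (t - x * t)).
    - apply Rmult_le_compat_l; [apply Rlt_le, exp_pos|apply exp_ineq1_le].
    - rewrite <- exp_plus. apply Req_le. f_equal. ring. }
  apply (Rmult_le_compat_l (1 - x)) in H1; [|lra].
  apply (Rmult_le_compat_l x) in H2; [|lra]. nra.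
Qed.

(** With [(n + 1)^x] in place of [n^x] Gauss's sequence increases on [0 <= x <= 1],
    by Bernoulli's inequality for the exponent [x]. *)
Lemma prod_lower (x : R) (n : nat) : 0 <= x <= 1 ->
  x * INR (fact n) * Rpower (INR n + 1) x <= prod_f_R0 (fun k => x + INR k) n.
Proof.
  intros Hx. induction n as [|n IH].
  - simpl. rewrite Rplus_0_l. unfold Rpower. rewrite ln_1, Rmult_0_r, exp_0. lra.
  - cbn [prod_f_R0]. rewrite fact_S_INR, S_INR, Rpower_succ.
    set (a := INR n) in *. assert (Ha : 0 <= a) by apply pos_INR.
    set (E := exp (x * (ln (a + 1 + 1) - ln (a + 1)))).
    assert (HE : E <= 1 + x * / (a + 1)).
    { eapply Rle_trans; [apply exp_convex; exact Hx|].
      replace (ln (a + 1 + 1) - ln (a + 1)) with (ln ((a + 1 + 1) / (a + 1)))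
        by (apply ln_div; lra).
      rewrite exp_ln by (apply Rdiv_lt_0_compat; lra). apply Req_le. field. lra. }
    assert (HE' : (a + 1) * E <= x + (a + 1)).
    { replace (x + (a + 1)) with ((a + 1) * (1 + x * / (a + 1))) by (field; lra).
      apply Rmult_le_compat_l; lra. }
    assert (0 <= x * INR (fact n) * Rpower (a + 1) x).
    { pose proof (INR_fact_lt_0 n). pose proof (Rpower_pos (a + 1) x). repeat apply Rmult_le_pos; lra. }
    apply Rle_trans with (x * INR (fact n) * Rpower (a + 1) x * ((a + 1) * E)).
    + apply Req_le. ring.
    + apply Rmult_le_compat; try lra.
      apply Rmult_le_pos; [lra|apply Rlt_le, exp_pos].
Qed.

(** Each factor is bounded through [1 - e/j <= exp (-e/j)] and
    [ln (j + 1) - ln j <= 1/j], and the bounds telescope. *)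
Lemma prod_upper (e : R) (n : nat) : 0 <= e <= 1 ->
  prod_f_R0 (fun k => 1 - e + INR k) n <=
  INR (fact n) * (INR n + 1) * Rpower (INR n + 1 + 1) (- e).
Proof.
  intros He.
  assert (Hstep : forall a, 0 <= a -> 1 - e + a <= (a + 1) * exp (- e * (ln (a + 1 + 1) - ln (a + 1)))).
  { intros a Ha.
    replace (1 - e + a) with ((a + 1) * (1 + - e * / (a + 1))) by (field; lra).
    apply Rmult_le_compat_l; [lra|].
    eapply Rle_trans; [apply exp_ineq1_le|]. apply exp_le_compat.
    pose proof (ln_succ_sub_upper (a + 1) ltac:(lra)). nra. }
  induction n as [|n IH].
  - specialize (Hstep 0 ltac:(lra)). simpl. rewrite !Rplus_0_l in *.
    rewrite ln_1 in Hstep. unfold Rpower.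
    replace (- e * (ln (1 + 1) - 0)) with (- e * ln (1 + 1)) in Hstep by ring. lra.
  - cbn [prod_f_R0]. rewrite fact_S_INR, S_INR, (Rpower_succ (INR n + 1 + 1)).
    specialize (Hstep (INR n + 1)). pose proof (pos_INR n).
    apply Rle_trans with ((INR (fact n) * (INR n + 1) * Rpower (INR n + 1 + 1) (- e)) *
      ((INR n + 1 + 1) * exp (- e * (ln (INR n + 1 + 1 + 1) - ln (INR n + 1 + 1))))).
    + apply Rmult_le_compat; [apply prod_nonneg; lra| lra|exact IH|apply Hstep; lra].
    + apply Req_le. ring.
Qed.

Lemma rgamma_lower (x : R) : 0 <= x <= 1 -> x <= rgamma x.
Proof.
  intros Hx. apply (is_lim_seq_le_loc (fun _ => x) (gauss_product x) x (rgamma x)).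
  - exists 1%nat. intros n Hn. assert (Hn0 : 0 < INR n) by (apply lt_0_INR; lia).
    pose proof (INR_fact_lt_0 n) as Hf. pose proof (Rpower_pos (INR n) x) as HR.
    apply Rle_div_r; [apply Rmult_lt_0_compat; lra|].
    eapply Rle_trans; [|now apply prod_lower].
    rewrite Rmult_assoc. apply Rmult_le_compat_l; [lra|].
    apply Rmult_le_compat_l; [lra|]. apply Rle_Rpower_l; lra.
  - apply is_lim_seq_const.
  - apply rgamma_is_lim.
Qed.

Lemma rgamma_upper (x : R) : 0 <= x -> rgamma x <= x * (1 + x).
Proof.
  intros Hx.
  pose proof (is_lim_seq_decr_compare (fun n => gauss_product x (S n)) (rgamma x)) as H.
  specialize (H (proj1 (is_lim_seq_incr_1 _ _) (rgamma_is_lim x))).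
  specialize (H (fun n => gauss_product_decreasing x (S n) Hx ltac:(lia)) 0%nat).
  cbv beta in H. unfold gauss_product in H. simpl in H.
  unfold Rpower in H. rewrite ln_1, Rmult_0_r, exp_0 in H. lra.
Qed.

Lemma rgamma_le_1 (e : R) : 0 <= e <= 1 -> rgamma (1 - e) <= 1.
Proof.
  intros He.
  apply (is_lim_seq_le_loc (gauss_product (1 - e)) (fun n => 1 + / INR n) (rgamma (1 - e)) 1).
  - exists 1%nat. intros n Hn. assert (Hn0 : 0 < INR n) by (apply lt_0_INR; lia).
    pose proof (INR_fact_lt_0 n) as Hf. pose proof (Rpower_pos (INR n) (1 - e)) as HR.
    apply Rle_div_l; [apply Rmult_lt_0_compat; lra|].
    eapply Rle_trans; [now apply prod_upper|].
    replace ((1 + / INR n) * (INR (fact n) * Rpower (INR n) (1 - e))) with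
      (INR (fact n) * (INR n + 1) * (Rpower (INR n) (1 - e) * / INR n)) by (field; lra).
    apply Rmult_le_compat_l; [apply Rmult_le_pos; lra|].
    replace (1 - e) with (1 + - e) by ring.
    rewrite Rpower_plus, Rpower_1 by lra.
    replace (INR n * Rpower (INR n) (- e) * / INR n) with (Rpower (INR n) (- e)) by (field; lra).
    rewrite !Rpower_Ropp. apply Rinv_le_contravar; [apply Rpower_pos|].
    apply Rle_Rpower_l; lra.
  - apply rgamma_is_lim.
  - replace (Finite 1) with (Finite (1 + 0)) by (f_equal; ring).
    apply is_lim_seq_plus'; [apply is_lim_seq_const|].
    evar_last; [apply is_lim_seq_inv; [apply is_lim_seq_INR|easy]|reflexivity].
Qed.

(** Together with the bound to the left of [1] this is the Lipschitz estimate at [1]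
    that keeps the difference quotients in [Y] bounded. *)
Lemma rgamma_right_of_1 (e : R) : 0 < e <= 1 -> 1 <= rgamma (1 + e) <= 1 + e.
Proof.
  intros He. pose proof (rgamma_shift e) as E.
  pose proof (rgamma_lower e ltac:(lra)). pose proof (rgamma_upper e ltac:(lra)).
  rewrite E in *. rewrite Rplus_comm. split; apply Rmult_le_reg_l with e; lra.
Qed.

Lemma rgamma_left_of_1 (e : R) : 0 <= e <= 1 -> 1 - e <= rgamma (1 - e) <= 1.
Proof.
  intros He. split; [apply rgamma_lower; lra|now apply rgamma_le_1].
Qed.

Lemma rgamma_1 : rgamma 1 = 1.
Proof. pose proof (rgamma_left_of_1 0 ltac:(lra)). rewrite Rminus_0_r in H. lra. Qed.

Lemma rgamma_pos (x : R) : 0 < x -> 0 < rgamma x.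
Proof.
  intros Hx.
  assert (H : forall N x, 0 < x <= INR N -> 0 < rgamma x).
  { induction N as [|N IH]; intros y Hy; [simpl in Hy; lra|].
    destruct (Rle_dec y 1) as [h|h].
    - pose proof (rgamma_lower y). lra.
    - rewrite S_INR in Hy. pose proof (rgamma_shift (y - 1)) as E.
      replace (y - 1 + 1) with y in E by ring.
      specialize (IH (y - 1) ltac:(lra)). rewrite E in IH.
      apply Rmult_lt_reg_l with (y - 1); lra. }
  destruct (nfloor_ex x ltac:(lra)) as [N HN].
  apply (H (S N)). rewrite S_INR. lra.
Qed.

(** Independence of [J] of orders [nu] and [- nu] rests on this. *)
Lemma rgamma_neq_0 (x : R) : (forall k : nat, x + INR k <> 0) -> rgamma x <> 0.
Proof.
  assert (H : forall N x, 0 < x + INR N -> (forall k : nat, x + INR k <> 0) -> rgamma x <> 0).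
  { induction N as [|N IH]; intros y Hy Hk.
    - simpl in Hy. apply Rgt_not_eq, rgamma_pos. lra.
    - rewrite S_INR in Hy. rewrite rgamma_shift. apply Rmult_integral_contrapositive. split.
      + specialize (Hk 0%nat). simpl in Hk. lra.
      + apply IH; [lra|]. intros k. specialize (Hk (S k)). rewrite S_INR in Hk. lra. }
  destruct (nfloor_ex (Rabs x) (Rabs_pos _)) as [N HN].
  apply (H (S N)). rewrite S_INR. pose proof (Rle_abs (- x)). rewrite Rabs_Ropp in H0. lra.
Qed.

(** * The logarithmic solution at integer order *)

Fixpoint harmonic (N : nat) : R :=
  match N with O => 0 | S N' => harmonic N' + / INR (S N') end.

(** The coefficients of [J] at the integer order [n]. *)
Definition int_coef (n m : nat) : R := (-1) ^ m / (INR (fact m) * INR (fact (n + m))).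

(** The classical series accompanying the logarithm; these coefficients are the
    derivatives at [e = 0] of the coefficient differences that occur in
    [Y] of order [n + e]. *)
Definition log_coef (n m : nat) : R :=
  if le_lt_dec n m
  then - (-1) ^ (m - n) * (harmonic m + harmonic (m - n))
         / (INR (fact m) * INR (fact (m - n)))
  else - INR (fact (n - m - 1)) / INR (fact m).

Lemma INR_S_neq_0 (m : nat) : INR (S m) <> 0.
Proof. apply not_0_INR. lia. Qed.

Lemma int_coef_recurrence (n m : nat) : frobenius_operator (INR n) (int_coef n) m = 0.
Proof.
  unfold frobenius_operator, int_coef.
  rewrite Nat.add_succ_r, !fact_S_INR, plus_INR, S_INR. simpl pow.
  pose proof (INR_fact_lt_0 m). pose proof (INR_fact_lt_0 (n + m)).
  pose proof (pos_INR m). pose proof (pos_INR n). field. repeat split; lra.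
Qed.

(** The right-hand side cancels what Bessel's operator produces from [2 ln (x/2) J]. *)
Lemma log_coef_recurrence (n m : nat) :
  frobenius_operator (- INR n) (log_coef n) m =
  - (PS_incr_n (fun i => (INR n + 2 * INR i) * int_coef n i) n (S m)).
Proof.
  rewrite PS_incr_n_simplify. unfold frobenius_operator, log_coef.
  destruct (le_lt_dec n (S m)) as [h|h]; destruct (le_lt_dec n m) as [h'|h']; try lia.
  - replace (S m - n)%nat with (S (m - n)) by lia.
    set (i := (m - n)%nat). replace m with (n + i)%nat by lia. clearbody i. clear.
    unfold int_coef. rewrite Nat.add_succ_r, !fact_S_INR. cbn [harmonic pow].
    rewrite !S_INR, !plus_INR.
    pose proof (INR_fact_lt_0 i). pose proof (INR_fact_lt_0 (n + i)).
    pose proof (pos_INR i). pose proof (pos_INR n). field. repeat split; lra.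
  - replace n with (S m) by lia. clear.
    replace (S m - m - 1)%nat with 0%nat by lia. rewrite !Nat.sub_diag.
    unfold int_coef. rewrite !Nat.add_0_r. rewrite !fact_S_INR, S_INR. simpl fact. simpl INR.
    pose proof (INR_fact_lt_0 m). pose proof (pos_INR m). field. repeat split; lra.
  - set (j := (n - S m - 1)%nat). replace (n - m - 1)%nat with (S j) by lia.
    replace n with (m + 2 + j)%nat by lia.
    rewrite !fact_S_INR, !plus_INR, S_INR. simpl (INR 2).
    pose proof (INR_fact_lt_0 m). pose proof (pos_INR m).
    unfold zero; simpl. field. split; lra.
Qed.

Lemma int_coef_entire (n : nat) : entire (int_coef n).
Proof.
  apply (entire_of_ratio _ 0 1). intros m _.
  pose proof (int_coef_recurrence n m) as H. unfold frobenius_operator in H.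
  rewrite Rmult_1_l.
  replace (int_coef n m) with (- (INR (S m) * (INR (S m) + INR n) * int_coef n (S m))) by lra.
  rewrite Rabs_Ropp, !Rabs_mult. pose proof (pos_INR n).
  assert (1 <= INR (S m)) by (rewrite S_INR; pose proof (pos_INR m); lra).
  rewrite (Rabs_pos_eq (INR (S m))), (Rabs_pos_eq (INR (S m) + _)) by lra.
  apply Rmult_le_compat_r; [apply Rabs_pos|]. nra.
Qed.

Lemma pow3_ge (m : nat) : INR m <= 3 ^ m.
Proof.
  induction m as [|m IH]; [simpl; lra|]. rewrite S_INR. simpl pow.
  assert (1 <= 3 ^ m) by (apply pow_R1_Rle; lra). lra.
Qed.

(** A majorant for the difference quotients of coefficients that is uniform in the
    order.  Truncated subtraction makes the factorial equal to [1] for [m <= n],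
    where those quotients are bounded by a constant depending on [n]. *)
Definition coef_majorant (n m : nat) : R := INR (fact (n + 2)) * 3 ^ m / INR (fact (m - n)).

Lemma coef_majorant_entire (n : nat) : entire (coef_majorant n).
Proof.
  apply (entire_of_ratio _ (2 * n) 6). intros m Hm. unfold coef_majorant.
  replace (S m - n)%nat with (S (m - n)) by lia.
  rewrite fact_S_INR. simpl pow.
  pose proof (INR_fact_lt_0 (n + 2)). pose proof (INR_fact_lt_0 (m - n)).
  assert (0 < 3 ^ m) by (apply pow_lt; lra).
  assert (H2 : INR (S m) <= 2 * (INR (m - n) + 1)).
  { rewrite <- S_INR. change 2 with (INR 2). rewrite <- mult_INR. apply le_INR. lia. }
  pose proof (pos_INR (m - n)).
  rewrite !Rabs_pos_eq.
  - replace (6 * (INR (fact (n + 2)) * 3 ^ m / INR (fact (m - n)))) with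
      ((2 * (INR (m - n) + 1)) *
       (INR (fact (n + 2)) * (3 * 3 ^ m) / ((INR (m - n) + 1) * INR (fact (m - n)))))
      by (field; lra).
    apply Rmult_le_compat_r; [|exact H2].
    apply Rdiv_le_0_compat; [|apply Rmult_lt_0_compat; lra].
    repeat apply Rmult_le_pos; lra.
  - apply Rdiv_le_0_compat; [apply Rmult_le_pos; lra|lra].
  - apply Rdiv_le_0_compat; [|apply Rmult_lt_0_compat; lra].
    repeat apply Rmult_le_pos; lra.
Qed.

(** Frobenius's second solution; it is [PI] times [Y] up to a multiple of [J]. *)
Definition log_solution (n : nat) (x : R) : R :=
  2 * ln (x / 2) * frobenius (INR n) (int_coef n) x + frobenius (- INR n) (log_coef n) x.
Definition log_solution_D (n : nat) (x : R) : R :=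
  2 * frobenius (INR n) (int_coef n) x
  + 2 * ln (x / 2) * frobenius_D (INR n) (int_coef n) x + frobenius_D (- INR n) (log_coef n) x.

(** Term by term, [s + 2 q d/dq] multiplies the [i]-th coefficient by [s + 2 i]. *)
Lemma PSeries_euler (s : R) (e : nat -> R) (q : R) : entire e ->
  PSeries (fun i => (s + 2 * INR i) * e i) q =
  s * PSeries e q + 2 * q * PSeries (PS_derive e) q.
Proof.
  intros He.
  assert (Hex : forall a, entire a -> ex_pseries a q).
  { intros a Ha. apply CV_radius_inside, entire_disk, Ha. }
  rewrite Rmult_assoc, <- PSeries_incr_1, <- !PSeries_scal, <- PSeries_plus.
  - apply PSeries_ext. intros [|m]; unfold PS_plus, PS_scal, PS_incr_1, PS_derive;
      unfold plus, scal, mult, zero; cbn -[INR]; unfold mult; cbn -[INR].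
    + simpl INR. ring.
    + ring.
  - apply ex_pseries_scal; [apply Rmult_comm|auto].
  - apply ex_pseries_scal; [apply Rmult_comm|].
    apply ex_pseries_incr_1. apply Hex, entire_derive, He.
Qed.

Lemma Rpower_half_square (n : nat) (x : R) : 0 < x ->
  ((x / 2) ^ 2) ^ n = Rpower (x / 2) (INR n) * Rpower (x / 2) (INR n).
Proof.
  intros Hx. rewrite Rpower_pow by lra. rewrite <- Rpow_mult_distr. f_equal. ring.
Qed.

(** Bessel's operator [D^2 + x^2 - n^2], [D = x d/dx], maps [2 ln (x/2) J] to
    [4 D J], and the power series part is built to compensate this. *)
Lemma log_solution_correct (n : nat) : entire (log_coef n) ->
  bessel_solution (INR n) (log_solution n) (log_solution_D n).
Proof.
  intros Hd x Hx.
  pose proof (int_coef_entire n) as Hc.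
  destruct (frobenius_solution (INR n) (int_coef n) Hc (int_coef_recurrence n) x Hx)
    as [HJ HJD].
  pose proof (frobenius_derive (- INR n) (log_coef n) x Hd Hx) as HT.
  pose proof (frobenius_D_derive (- INR n) (log_coef n) x Hd Hx) as HTD.
  assert (HL : is_derive (fun x => ln (x / 2)) x (/ x)).
  { auto_derive; [lra|]. field. lra. }
  set (q := (x / 2) ^ 2) in *.
  assert (Key : Rpower (x / 2) (- INR n) * x * PSeries (frobenius_operator (- INR n) (log_coef n)) q
    = - 4 * frobenius_D (INR n) (int_coef n) x / x).
  { assert (E : q * PSeries (frobenius_operator (- INR n) (log_coef n)) q
      = - (q ^ n * (INR n * PSeries (int_coef n) q + 2 * q * PSeries (PS_derive (int_coef n)) q))).
    { rewrite <- PSeries_euler by exact Hc.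
      rewrite <- PSeries_incr_n, <- PSeries_incr_1, <- PSeries_opp.
      apply PSeries_ext. intros [|m].
      - unfold PS_opp, PS_incr_1. rewrite PS_incr_n_simplify. destruct le_lt_dec as [h|h].
        + replace n with 0%nat by lia. unfold opp, zero; simpl. ring.
        + unfold opp, zero; simpl. ring.
      - apply log_coef_recurrence. }
    unfold frobenius_D. fold q.
    pose proof (Rpower_half_opp (INR n) x) as HR.
    unfold q at 3 in E. rewrite (Rpower_half_square n x Hx) in E.
    set (A := Rpower (x / 2) (INR n)) in *. set (B := Rpower (x / 2) (- INR n)) in *.
    set (P := PSeries (frobenius_operator (- INR n) (log_coef n)) q) in *.
    set (V := INR n * PSeries (int_coef n) q + 2 * q * PSeries (PS_derive (int_coef n)) q) in *.
    assert (Eq : x ^ 2 = 4 * q) by (unfold q; field).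
    field_simplify_eq; [|lra].
    transitivity (4 * B * (q * P)); [rewrite Eq; ring|].
    rewrite E. transitivity (- 4 * (A * B) * A * V); [ring|]. rewrite HR. ring. }
  rewrite Key in HTD. clear Key.
  unfold log_solution, log_solution_D. 
  set (J := frobenius (INR n) (int_coef n)) in *.
  set (JD := frobenius_D (INR n) (int_coef n)) in *.
  set (T := frobenius (- INR n) (log_coef n)) in *.
  set (TD := frobenius_D (- INR n) (log_coef n)) in *.
  set (L := fun x : R => ln (x / 2)) in *.
  change (ln (x / 2)) with (L x) in *.
  change (is_derive L x (/ x)) in HL.
  change (is_derive (fun x => 2 * L x * J x + T x) x ((2 * J x + 2 * L x * JD x + TD x) / x) /\
    is_derive (fun x => 2 * J x + 2 * L x * JD x + TD x) x
     (- ((x ^ 2 - INR n ^ 2) / x) * (2 * L x * J x + T x))).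
  clearbody J JD T TD L.
  split; auto_derive.
  1, 3: repeat split; eexists; eassumption.
  - rewrite (Derive_value _ _ _ HL), (Derive_value _ _ _ HJ), (Derive_value _ _ _ HT).
    field. lra.
  - rewrite (Derive_value _ _ _ HL), (Derive_value _ _ _ HJ), (Derive_value _ _ _ HJD),
      (Derive_value _ _ _ HTD).
    field. lra.
Qed.

Lemma log_solution_wronskian (n : nat) : entire (log_coef n) -> forall x, 0 < x ->
  wronskian (frobenius (INR n) (int_coef n)) (frobenius_D (INR n) (int_coef n))
    (log_solution n) (log_solution_D n) x = 2.
Proof.
  intros Hd.
  pose proof (int_coef_entire n) as Hc.
  set (c := int_coef n) in *. set (d := log_coef n) in *.
  set (g := fun q => 2 * q ^ n * PSeries c q ^ 2 - 2 * INR n * PSeries c q * PSeries d q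
    + 2 * q * (PSeries c q * PSeries (PS_derive d) q - PSeries (PS_derive c) q * PSeries d q)).
  assert (Eg : g 0 = 2).
  { unfold g. rewrite !PSeries_0. unfold c, d, int_coef, log_coef.
    destruct n as [|n].
    - simpl. field.
    - destruct le_lt_dec as [h|h]; [lia|].
      replace (S n - 0 - 1)%nat with n by lia.
      rewrite Nat.add_0_r, fact_S_INR, S_INR, pow_i by lia. simpl.
      pose proof (INR_fact_lt_0 n). pose proof (pos_INR n). field. split; lra. }
  rewrite <- Eg. apply constant_value_at_0.
  - apply (wronskian_constant (INR n)).
    + now apply frobenius_solution, int_coef_recurrence.
    + now apply log_solution_correct.
  - intros x Hx. unfold wronskian, log_solution, log_solution_D, frobenius, frobenius_D, g.
    fold c d. rewrite (Rpower_half_square n x Hx).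
    pose proof (Rpower_half_opp (INR n) x) as HR.
    set (A := Rpower (x / 2) (INR n)) in *. set (B := Rpower (x / 2) (- INR n)) in *.
    set (q := (x / 2) ^ 2).
    transitivity (2 * (A * A) * PSeries c q ^ 2 + (A * B) * (- 2 * INR n * PSeries c q * PSeries d q
     + 2 * q * (PSeries c q * PSeries (PS_derive d) q - PSeries (PS_derive c) q * PSeries d q)));
     [ring|]. rewrite HR. ring.
  - apply (ex_derive_continuous g). unfold g.
    assert (E : forall e, entire e -> ex_derive (PSeries e) 0)
      by (intros; now apply ex_derive_PSeries, entire_disk).
    auto_derive. repeat split; apply E; repeat apply entire_derive; assumption.
Qed.

(** * Limits under a dominated sum and under a bounded perturbation *)

(** Tannery's theorem: cut the series where the tail of the majorant is small. *)
Lemma Series_dominated (a : nat -> nat -> R) (l b : nat -> R) :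
  ex_series b -> (forall p m, Rabs (a p m) <= b m) ->
  (forall m, is_lim_seq (fun p => a p m) (l m)) ->
  is_lim_seq (fun p => Series (a p)) (Series l).
Proof.
  intros Hb Ha Hl.
  assert (Hlb : forall m, Rabs (l m) <= b m).
  { intros m. apply (is_lim_seq_le (fun p => Rabs (a p m)) (fun _ => b m) (Rabs (l m)) (b m)).
    - auto.
    - exact (is_lim_seq_abs _ _ (Hl m)).
    - apply is_lim_seq_const. }
  assert (Hex : forall u, (forall m, Rabs (u m) <= b m) -> ex_series u).
  { intros u Hu. apply (ex_series_le u b); [exact Hu|exact Hb]. }
  assert (Htail : forall u N, (forall m, Rabs (u m) <= b m) ->
    Rabs (Series u - sum_f_R0 u N) <= Series b - sum_f_R0 b N).
  { intros u N Hu.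
    rewrite (Series_incr_n u (S N)), (Series_incr_n b (S N)); try lia; auto.
    simpl pred.
    replace (_ + _ - _) with (Series (fun k => u (S N + k)%nat)) by ring.
    replace (sum_f_R0 b N + _ - _) with (Series (fun k => b (S N + k)%nat)) by ring.
    eapply Rle_trans; [apply Series_Rabs|].
    - apply (ex_series_le (fun n => Rabs (u (S N + n)%nat)) (fun n => b (S N + n)%nat)).
      + intros n. unfold norm; simpl; unfold abs; simpl. rewrite Rabs_Rabsolu. apply (Hu (S N + n)%nat).
      + now apply (ex_series_incr_n b (S N)).
    - apply Series_le.
      + intros n. split; [apply Rabs_pos|apply Hu].
      + now apply (ex_series_incr_n b (S N)). }
  apply is_lim_seq_spec. intros eps.
  assert (He : 0 < eps / 4) by (pose proof (cond_pos eps); lra).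
  assert (HbS : is_lim_seq (sum_f_R0 b) (Series b)).
  { pose proof (Series_correct _ Hb) as H.
    apply is_lim_seq_ext with (sum_n b); [intros n; apply sum_n_Reals|exact H]. }
  apply is_lim_seq_spec in HbS. destruct (HbS (mkposreal _ He)) as [N HN].
  specialize (HN N (Nat.le_refl N)). simpl in HN. apply Rabs_def2 in HN.
  assert (Hsum : is_lim_seq (fun p => sum_f_R0 (a p) N) (sum_f_R0 l N)).
  { clear HN. induction N as [|N IH]; simpl; [apply Hl|].
    now apply is_lim_seq_plus'. }
  apply is_lim_seq_spec in Hsum. destruct (Hsum (mkposreal _ He)) as [P HP].
  exists P. intros p Hp. specialize (HP p Hp). simpl in HP. apply Rabs_def2 in HP.
  pose proof (Htail (a p) N (Ha p)) as T1. pose proof (Htail l N Hlb) as T2.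
  apply Rabs_le_between in T1. apply Rabs_le_between in T2.
  apply Rabs_def1; lra.
Qed.

Lemma PSeries_dominated (a : nat -> nat -> R) (l b : nat -> R) (x : R) :
  entire b -> (forall p m, Rabs (a p m) <= b m) ->
  (forall m, is_lim_seq (fun p => a p m) (l m)) ->
  is_lim_seq (fun p => PSeries (a p) x) (PSeries l x).
Proof.
  intros Hb Ha Hl. unfold PSeries.
  apply (Series_dominated _ _ (fun m => Rabs (b m * x ^ m))).
  - now apply CV_disk_inside, entire_disk.
  - intros p m. rewrite !Rabs_mult. apply Rmult_le_compat_r; [apply Rabs_pos|].
    eapply Rle_trans; [apply Ha|apply Rle_abs].
  - intros m. apply is_lim_seq_mult'; [apply Hl|apply is_lim_seq_const].
Qed.

Lemma is_lim_seq_dominated (u : nat -> R) (l b : R) :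
  is_lim_seq u l -> (forall p, Rabs (u p) <= b) -> Rabs l <= b.
Proof.
  intros H Hb. apply (is_lim_seq_le (fun p => Rabs (u p)) (fun _ => b) (Rabs l) b).
  - exact Hb.
  - exact (is_lim_seq_abs _ _ H).
  - apply is_lim_seq_const.
Qed.

Lemma LimSup_bounded_perturbation (u w : nat -> R) (a K : R) :
  is_lim_seq (fun n => u n - w n) a -> (forall n, Rabs (w n) <= K) ->
  exists l, is_LimSup_seq w (Finite l) /\ is_LimSup_seq u (Finite (a + l)).
Proof.
  intros Hu HK.
  assert (HK' : forall n, - K <= w n <= K) by (intros n; apply Rabs_le_between, HK).
  destruct (ex_LimSup_seq w) as [[l| |] Hl].
  - exists l. split; [exact Hl|]. intros eps.
    assert (He : 0 < eps / 2) by (pose proof (cond_pos eps); lra).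
    apply is_lim_seq_spec in Hu. destruct (Hu (mkposreal _ He)) as [P HP].
    destruct (Hl (mkposreal _ He)) as [H1 [N2 H2]]. simpl in *. split.
    + intros N. destruct (H1 (N + P)%nat) as [n [Hn1 Hn2]]. exists n. split; [lia|].
      specialize (HP n ltac:(lia)). apply Rabs_def2 in HP. lra.
    + exists (N2 + P)%nat. intros n Hn.
      specialize (HP n ltac:(lia)). apply Rabs_def2 in HP. specialize (H2 n ltac:(lia)). lra.
  - exfalso. destruct (Hl K 0%nat) as [n [_ Hn]]. specialize (HK' n). lra.
  - exfalso. destruct (Hl (- K)) as [N HN]. specialize (HN N (Nat.le_refl N)).
    specialize (HK' N). lra.
Qed.

(** [Lim_seq] is the mean of the upper and lower limits, so it is additive when one
    of the two sequences converges, even if the other one does not. *)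
Lemma Lim_seq_bounded_perturbation (u w : nat -> R) (a K : R) :
  is_lim_seq (fun n => u n - w n) a -> (forall n, Rabs (w n) <= K) ->
  exists l, Lim_seq w = Finite l /\ Lim_seq u = Finite (a + l).
Proof.
  intros Hu HK.
  destruct (LimSup_bounded_perturbation u w a K Hu HK) as [s [Hs1 Hs2]].
  destruct (LimSup_bounded_perturbation (fun n => - u n) (fun n => - w n) (- a) K) as [i [Hi1 Hi2]].
  - apply is_lim_seq_ext with (fun n => - (u n - w n)); [intros; ring|].
    exact (proj1 (is_lim_seq_opp _ _) Hu).
  - intros n. rewrite Rabs_Ropp. apply HK.
  - assert (Hi1' : is_LimInf_seq w (Finite (- i)))
      by (apply is_LimSup_opp_LimInf_seq; cbn [Rbar_opp]; now rewrite Ropp_involutive).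
    assert (Hi2' : is_LimInf_seq u (Finite (a - i))).
    { apply is_LimSup_opp_LimInf_seq. cbn [Rbar_opp].
      replace (- (a - i)) with (- a + i) by ring. exact Hi2. }
    exists ((s + - i) / 2). unfold Lim_seq.
    rewrite (is_LimSup_seq_unique _ _ Hs1), (is_LimSup_seq_unique _ _ Hs2).
    rewrite (is_LimInf_seq_unique _ _ Hi1'), (is_LimInf_seq_unique _ _ Hi2').
    split; simpl; f_equal; field.
Qed.

(** In [Y] the bounded factor [ta] comes from [1 / Gamma]; differentiability of
    [1 / Gamma] at [1] is thereby avoided. *)
Lemma Lim_seq_bounded_combination (al be ta : nat -> R) (a b K : R) :
  is_lim_seq al a -> is_lim_seq be b -> (forall n, Rabs (ta n) <= K) ->
  real (Lim_seq (fun n => al n + ta n * be n)) = a + b * real (Lim_seq ta).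
Proof.
  intros Ha Hb HK.
  destruct (Lim_seq_bounded_perturbation (fun n => al n + ta n * be n) (fun n => b * ta n) a (Rabs b * K))
    as [l [E1 E2]].
  - apply is_lim_seq_ext with (fun n => al n + ta n * (be n - b)); [intros; ring|].
    replace (Finite a) with (Finite (a + 0)) by (f_equal; ring).
    apply is_lim_seq_plus'; [exact Ha|].
    apply is_lim_seq_abs_0.
    apply (is_lim_seq_le_le (fun _ => 0) _ (fun n => K * Rabs (be n - b))).
    + intros n. split; [apply Rabs_pos|]. rewrite Rabs_mult.
      apply Rmult_le_compat_r; [apply Rabs_pos|apply HK].
    + apply is_lim_seq_const.
    + replace (Finite 0) with (Finite (K * Rabs (b - b)))
        by (f_equal; rewrite Rminus_diag, Rabs_R0; ring).
      apply is_lim_seq_mult'; [apply is_lim_seq_const|].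
      apply (is_lim_seq_abs _ (Finite (b - b))).
      apply is_lim_seq_minus'; [exact Hb|apply is_lim_seq_const].
  - intros n. rewrite Rabs_mult. apply Rmult_le_compat_l; [apply Rabs_pos|apply HK].
  - rewrite E2. simpl. f_equal.
    destruct (Lim_seq_bounded_perturbation ta ta 0 K) as [l' [E3 _]]; [|exact HK|].
    + apply is_lim_seq_ext with (fun _ => 0); [intros; ring|apply is_lim_seq_const].
    + rewrite Lim_seq_scal_l, E3 in E1. rewrite E3. simpl in *. now injection E1.
Qed.

Lemma is_lim_seq_difference_quotient (f : R -> R) (e : nat -> R) (l : R) :
  is_derive f 0 l -> (forall p, e p <> 0) -> is_lim_seq e 0 ->
  is_lim_seq (fun p => (f (e p) - f 0) / e p) l.
Proof.
  intros Hf He0 He. apply is_derive_Reals in Hf.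
  apply is_lim_seq_spec. intros eps.
  destruct (Hf eps (cond_pos eps)) as [d Hd].
  apply is_lim_seq_spec in He. destruct (He d) as [P HP].
  exists P. intros p Hp. specialize (HP p Hp). rewrite Rminus_0_r in HP.
  specialize (Hd (e p) (He0 p) HP). now rewrite Rplus_0_l in Hd.
Qed.

Lemma is_lim_seq_composite (f : R -> R) (e : nat -> R) :
  ex_derive f 0 -> is_lim_seq e 0 -> is_lim_seq (fun p => f (e p)) (f 0).
Proof.
  intros Hf He. apply (is_lim_seq_continuous f e 0); [|exact He].
  apply continuity_pt_filterlim. now apply (ex_derive_continuous f).
Qed.

(** * Coefficients near an integer order *)

(** The product of [1 + e/j] over [1 <= j <= N], that is
    [Gamma (1 + e + N) / (N! Gamma (1 + e))]. *)
Fixpoint rprod (N : nat) (e : R) : R :=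
  match N with O => 1 | S N' => rprod N' e * (1 + e / INR (S N')) end.

Lemma rprod_ge_1 (N : nat) (e : R) : 0 <= e -> 1 <= rprod N e.
Proof.
  intros He. induction N as [|N IH]; cbn [rprod]; [lra|].
  assert (0 <= e / INR (S N)) by (apply Rdiv_le_0_compat; [lra|apply lt_0_INR; lia]). nra.
Qed.

Lemma rprod_pos (N : nat) (e : R) : -1 < e -> 0 < rprod N e.
Proof.
  intros He. induction N as [|N IH]; cbn [rprod]; [lra|].
  apply Rmult_lt_0_compat; [exact IH|].
  assert (1 <= INR (S N)) by (rewrite S_INR; pose proof (pos_INR N); lra).
  replace (1 + e / INR (S N)) with ((INR (S N) + e) / INR (S N)) by (field; lra).
  apply Rdiv_lt_0_compat; lra.
Qed.

Lemma step_ratio_bounds (N : nat) (e : R) : 0 <= e -> 0 <= e / INR (S N) <= e.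
Proof.
  intros He.
  assert (1 <= INR (S N)) by (rewrite S_INR; pose proof (pos_INR N); lra).
  split; [apply Rdiv_le_0_compat; lra|].
  apply Rle_div_l; nra.
Qed.

Lemma rprod_le_succ (N : nat) (e : R) : 0 <= e <= 1 -> rprod N e <= INR N + 1.
Proof.
  intros He. induction N as [|N IH]; cbn [rprod]; [simpl; lra|].
  rewrite S_INR. pose proof (pos_INR N).
  apply Rle_trans with ((INR N + 1) * (1 + e / (INR N + 1))).
  - apply Rmult_le_compat_r; [|exact IH].
    assert (0 <= e / (INR N + 1)) by (apply Rdiv_le_0_compat; lra). lra.
  - replace ((INR N + 1) * (1 + e / (INR N + 1))) with (INR N + 1 + e) by (field; lra). lra.
Qed.

Lemma inv_rprod_bounds (N : nat) (e : R) : 0 <= e <= 1 / 2 -> 1 - INR N * e <= / rprod N e <= 1.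
Proof.
  intros He. induction N as [|N IH]; cbn [rprod].
  - simpl. rewrite Rinv_1. lra.
  - pose proof (step_ratio_bounds N e ltac:(lra)) as Hd.
    set (d := e / INR (S N)) in *. rewrite Rinv_mult, S_INR.
    assert (H1 : 1 - d <= / (1 + d) <= 1).
    { split.
      - apply Rmult_le_reg_r with (1 + d); [lra|]. rewrite Rinv_l by lra. nra.
      - rewrite <- Rinv_1. apply Rinv_le_contravar; lra. }
    assert (0 < / rprod N e) by (apply Rinv_0_lt_compat, rprod_pos; lra). nra.
Qed.

Lemma inv_rprod_opp_bounds (N : nat) (e : R) : 0 <= e <= 1 / 2 ->
  1 <= / rprod N (- e) <= 1 + (3 ^ N - 1) * e.
Proof.
  intros He. induction N as [|N IH]; cbn [rprod].
  - simpl. rewrite Rinv_1. lra.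
  - pose proof (step_ratio_bounds N e ltac:(lra)) as Hd.
    replace (- e / INR (S N)) with (- (e / INR (S N))) by (unfold Rdiv; ring).
    set (d := e / INR (S N)) in *. rewrite Rinv_mult. simpl pow.
    assert (H1 : 1 <= / (1 + - d) <= 1 + 2 * e).
    { split.
      - rewrite <- Rinv_1 at 1. apply Rinv_le_contravar; lra.
      - apply Rmult_le_reg_r with (1 + - d); [lra|]. rewrite Rinv_l by lra. nra. }
    assert (H3 : 1 <= 3 ^ N) by (apply pow_R1_Rle; lra).
    set (v := / rprod N (- e)) in *. set (T := 3 ^ N) in *. set (y := / (1 + - d)) in *.
    split; [nra|].
    apply Rle_trans with ((1 + (T - 1) * e) * (1 + 2 * e)); [apply Rmult_le_compat; lra|].
    assert ((T - 1) * e * (2 * e) <= (T - 1) * e * 1) by (apply Rmult_le_compat_l; nra).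
    nra.
Qed.

Lemma rprod_0 (N : nat) : rprod N 0 = 1.
Proof.
  induction N as [|N IH]; cbn [rprod]; [easy|]. rewrite IH. unfold Rdiv. ring.
Qed.

Lemma rprod_derive_0 (N : nat) : is_derive (rprod N) 0 (harmonic N).
Proof.
  induction N as [|N IH]; cbn [rprod harmonic].
  - apply @is_derive_const.
  - auto_derive; [repeat split; eexists; eassumption|].
    rewrite (Derive_value _ _ _ IH), rprod_0. pose proof (INR_S_neq_0 N).
    change (match N with O => 1 | S _ => INR N + 1 end) with (INR (S N)).
    field. assumption.
Qed.

Lemma rgamma_rprod (N : nat) (e : R) :
  rgamma (1 + e) = INR (fact N) * rprod N e * rgamma (1 + e + INR N).
Proof.
  induction N as [|N IH].
  - simpl. rewrite Rplus_0_r. ring.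
  - rewrite IH, (rgamma_shift (1 + e + INR N)), fact_S_INR. cbn [rprod].
    rewrite S_INR. replace (1 + e + (INR N + 1)) with (1 + e + INR N + 1) by ring.
    pose proof (pos_INR N). field. lra.
Qed.

(** Carries the factor [e] that expresses the zero of [1 / Gamma] at the
    nonpositive integer [- N]. *)
Lemma rgamma_rprod_neg (N : nat) (e : R) :
  rgamma (- INR N - e) = (-1) ^ (S N) * e * INR (fact N) * rprod N e * rgamma (1 - e).
Proof.
  induction N as [|N IH].
  - rewrite rgamma_shift. simpl. replace (- 0 - e + 1) with (1 - e) by ring. ring.
  - rewrite rgamma_shift, S_INR. replace (- (INR N + 1) - e + 1) with (- INR N - e) by ring.
    rewrite IH, fact_S_INR. cbn [rprod]. rewrite S_INR. simpl pow.
    pose proof (pos_INR N). field. lra.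
Qed.

(** The coefficients of [J] of order [n + e], divided by [1 / Gamma (1 + e)]. *)
Definition shifted_coef (n : nat) (e : R) (i : nat) : R :=
  (-1) ^ i / (INR (fact i) * INR (fact (n + i)) * rprod (n + i) e).

(** Difference quotient between the coefficients of [J] of orders [n + e] and
    [- n - e]; for [m < n] the first order contributes nothing and the second one
    has a factor [e] that has been cancelled. *)
Definition quotient_coef (n : nat) (e : R) (m : nat) : R :=
  if le_lt_dec n m
  then (-1) ^ (m - n) / (INR (fact m) * INR (fact (m - n)))
       * ((/ rprod m e - / rprod (m - n) (- e)) / e)
  else - INR (fact (n - m - 1)) * rprod (n - m - 1) e / INR (fact m).

Lemma neg1_pow_square (a : nat) : (-1) ^ a * (-1) ^ a = 1.
Proof. rewrite <- Rpow_mult_distr. replace (-1 * -1) with 1 by ring. apply pow1. Qed.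

Lemma bessel_J_coef_pos (n : nat) (e : R) (m : nat) : 0 < e ->
  (-1) ^ m / INR (fact m) * rgamma (INR m + (INR n + e) + 1)
  = rgamma (1 + e) * shifted_coef n e m.
Proof.
  intros He. rewrite (rgamma_rprod (n + m) e). unfold shifted_coef.
  rewrite plus_INR.
  replace (1 + e + (INR n + INR m)) with (INR m + (INR n + e) + 1) by ring.
  pose proof (INR_fact_lt_0 m). pose proof (INR_fact_lt_0 (n + m)).
  pose proof (rprod_pos (n + m) e ltac:(lra)). field. repeat split; lra.
Qed.

(** Aligning the powers of [x/2] shifts the coefficients of order [n + e] by [n]
    places; what differs from them is of size [e]. *)
Lemma bessel_J_coef_neg (n : nat) (e : R) (m : nat) : 0 < e < 1 ->
  (-1) ^ m / INR (fact m) * rgamma (INR m + - (INR n + e) + 1)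
  = (-1) ^ n * rgamma (1 - e) *
    (PS_incr_n (shifted_coef n e) n m - e * quotient_coef n e m).
Proof.
  intros He. rewrite PS_incr_n_simplify. unfold quotient_coef, shifted_coef.
  pose proof (INR_fact_lt_0 m) as Hm.
  destruct le_lt_dec as [h|h].
  - set (i := (m - n)%nat). replace m with (n + i)%nat in * by lia. clearbody i.
    pose proof (rgamma_rprod i (- e)) as E.
    replace (1 + - e + INR i) with (INR (n + i) + - (INR n + e) + 1) in E
      by (rewrite plus_INR; ring).
    replace (1 + - e) with (1 - e) in E by ring. rewrite E.
    pose proof (INR_fact_lt_0 i).
    pose proof (rprod_pos (n + i) e ltac:(lra)). pose proof (rprod_pos i (- e) ltac:(lra)).
    rewrite pow_add. pose proof (neg1_pow_square n) as Hn.
    field. repeat split; lra.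
  - set (N := (n - m - 1)%nat). replace n with (m + S N)%nat by lia. clearbody N.
    replace (INR m + - (INR (m + S N) + e) + 1) with (- INR N - e)
      by (rewrite plus_INR, S_INR; ring).
    rewrite rgamma_rprod_neg, pow_add. unfold zero; simpl (AbelianMonoid.zero _). 
    pose proof (neg1_pow_square (S N)) as Hn.
    pose proof (neg1_pow_square m) as Hm2.
    transitivity ((-1) ^ m * (-1) ^ S N * e * INR (fact N) * rprod N e * rgamma (1 - e) / INR (fact m));
      [field; lra|].
    cbn. field. lra.
Qed.

Lemma fact_ge_1 (m : nat) : 1 <= INR (fact m).
Proof. change 1 with (INR 1). apply le_INR, lt_O_fact. Qed.

Lemma Rabs_neg1_pow (m : nat) : Rabs ((-1) ^ m) = 1.
Proof. apply pow_1_abs. Qed.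

Lemma shifted_coef_bound (n : nat) (e : R) (i : nat) : 0 < e <= 1 / 2 ->
  Rabs (shifted_coef n e i) <= / INR (fact i).
Proof.
  intros He. unfold shifted_coef.
  pose proof (INR_fact_lt_0 i). pose proof (fact_ge_1 (n + i)).
  pose proof (rprod_ge_1 (n + i) e ltac:(lra)).
  unfold Rdiv. rewrite Rabs_mult, Rabs_neg1_pow, Rmult_1_l.
  assert (INR (fact i) <= INR (fact i) * INR (fact (n + i)) * rprod (n + i) e).
  { rewrite Rmult_assoc. rewrite <- (Rmult_1_r (INR (fact i))) at 1.
    apply Rmult_le_compat_l; [lra|]. nra. }
  rewrite Rabs_pos_eq; [|apply Rlt_le, Rinv_0_lt_compat; lra].
  apply Rinv_le_contravar; lra.
Qed.

(** For [m >= n] the two reciprocal products differ by at most [e (m + 3^m)]; for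
    [m < n] and [N = n - m - 1] the product is at most [N + 1], and [N! (N + 1) <= n!]. *)
Lemma quotient_coef_bound (n : nat) (e : R) (m : nat) : 0 < e <= 1 / 2 ->
  Rabs (quotient_coef n e m) <= coef_majorant n m.
Proof.
  intros He. unfold quotient_coef, coef_majorant.
  pose proof (fact_ge_1 m) as Hm. 
  assert (H3 : 1 <= 3 ^ m) by (apply pow_R1_Rle; lra).
  destruct le_lt_dec as [h|h].
  - set (i := (m - n)%nat). pose proof (fact_ge_1 i) as Hi.
    pose proof (inv_rprod_bounds m e ltac:(lra)) as B1.
    pose proof (inv_rprod_opp_bounds i e ltac:(lra)) as B2.
    assert (Hpow : 3 ^ i <= 3 ^ m) by (apply Rle_pow; [lra|unfold i; lia]).
    pose proof (pow3_ge m) as Hp.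
    assert (HQ : Rabs ((/ rprod m e - / rprod i (- e)) / e) <= 2 * 3 ^ m).
    { unfold Rdiv. rewrite Rabs_mult, (Rabs_pos_eq (/ e)) by (apply Rlt_le, Rinv_0_lt_compat; lra).
      apply Rle_div_l; [lra|]. apply Rabs_le. split; nra. }
    rewrite Rabs_mult. unfold Rdiv at 1. rewrite Rabs_mult, Rabs_neg1_pow, Rmult_1_l.
    rewrite (Rabs_pos_eq (/ (_ * _))) by (apply Rlt_le, Rinv_0_lt_compat; nra).
    apply Rle_trans with (/ INR (fact i) * (2 * 3 ^ m)).
    + apply Rmult_le_compat; [apply Rlt_le, Rinv_0_lt_compat; nra|apply Rabs_pos| |exact HQ].
      apply Rinv_le_contravar; nra.
    + unfold Rdiv. rewrite (Rmult_comm _ (/ INR (fact i))).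
      apply Rmult_le_compat_l; [apply Rlt_le, Rinv_0_lt_compat; lra|].
      apply Rmult_le_compat_r; [lra|].
      change 2 with (INR (fact 2)). apply le_INR, fact_le. lia.
  - replace (m - n)%nat with 0%nat by lia. simpl (INR (fact 0)). rewrite Rdiv_1_r.
    set (N := (n - m - 1)%nat).
    pose proof (fact_ge_1 N) as HN.
    pose proof (rprod_ge_1 N e ltac:(lra)). pose proof (rprod_le_succ N e ltac:(lra)).
    assert (Hf : INR (fact N) * (INR N + 1) <= INR (fact (n + 2))).
    { rewrite Rmult_comm, <- fact_S_INR. apply le_INR, fact_le. unfold N. lia. }
    unfold Rdiv. rewrite !Rabs_mult, Rabs_Ropp, (Rabs_pos_eq (INR (fact N))),
      (Rabs_pos_eq (rprod N e)), (Rabs_pos_eq (/ _)) by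
      (try lra; apply Rlt_le, Rinv_0_lt_compat; lra).
    assert (/ INR (fact m) <= 1) by (rewrite <- Rinv_1; apply Rinv_le_contravar; lra).
    assert (0 < / INR (fact m)) by (apply Rinv_0_lt_compat; lra).
    apply Rle_trans with (INR (fact (n + 2)) * 1).
    + apply Rmult_le_compat; try lra; [nra|].
      eapply Rle_trans; [|exact Hf]. apply Rmult_le_compat_l; lra.
    + apply Rmult_le_compat_l; [nra|exact H3].
Qed.

Lemma inv_fact_entire : entire (fun i => / INR (fact i)).
Proof.
  apply (entire_of_ratio _ 0 1). intros m _. rewrite Rmult_1_l, fact_S_INR, S_INR.
  pose proof (INR_fact_lt_0 m). pose proof (pos_INR m).
  rewrite !Rabs_pos_eq by (apply Rlt_le, Rinv_0_lt_compat; nra).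
  apply Req_le. field. lra.
Qed.

Lemma shifted_coef_lim (e : nat -> R) (n m : nat) : is_lim_seq e 0 ->
  is_lim_seq (fun p => shifted_coef n (e p) m) (int_coef n m).
Proof.
  intros He0.
  replace (int_coef n m) with (shifted_coef n 0 m)
    by (unfold shifted_coef, int_coef; now rewrite rprod_0, Rmult_1_r).
  apply (is_lim_seq_composite (fun e => shifted_coef n e m)); [|exact He0].
  unfold shifted_coef.
  pose proof (rprod_derive_0 (n + m)) as H. pose proof (rprod_0 (n + m)) as H0.
  pose proof (INR_fact_lt_0 m). pose proof (INR_fact_lt_0 (n + m)).
  auto_derive. repeat split; [eexists; exact H|]. rewrite H0.
  repeat apply Rmult_integral_contrapositive_currified; lra.
Qed.

Lemma quotient_coef_lim (e : nat -> R) (n m : nat) :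
  (forall p, 0 < e p <= 1 / 2) -> is_lim_seq e 0 ->
  is_lim_seq (fun p => quotient_coef n (e p) m) (log_coef n m).
Proof.
  intros He He0.
  unfold quotient_coef, log_coef. destruct le_lt_dec as [h|h].
  - set (i := (m - n)%nat).
    replace (- (-1) ^ i * (harmonic m + harmonic i) / (INR (fact m) * INR (fact i))) with
      ((-1) ^ i / (INR (fact m) * INR (fact i)) * (- harmonic m - harmonic i))
      by (unfold Rdiv; ring).
    apply is_lim_seq_mult'; [apply is_lim_seq_const|].
    apply is_lim_seq_ext with (fun p => ((fun e => / rprod m e - / rprod i (- e)) (e p)
      - (fun e => / rprod m e - / rprod i (- e)) 0) / e p).
    + intros p. rewrite Ropp_0, !rprod_0. f_equal. ring.
    + apply (is_lim_seq_difference_quotient (fun e => / rprod m e - / rprod i (- e)) e); [| |exact He0].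
      * pose proof (rprod_derive_0 m) as H1.
        assert (H2 : is_derive (rprod i) (- 0) (harmonic i)) by (rewrite Ropp_0; apply rprod_derive_0).
        auto_derive.
        -- repeat split; try (eexists; eassumption); rewrite ?Ropp_0, rprod_0; lra.
        -- rewrite (Derive_value _ _ _ H1), (Derive_value _ _ _ H2), Ropp_0, !rprod_0. field.
      * intros p. specialize (He p). lra.
  - set (N := (n - m - 1)%nat).
    replace (- INR (fact N) / INR (fact m)) with (- INR (fact N) * rprod N 0 / INR (fact m))
      by (rewrite rprod_0; unfold Rdiv; ring).
    apply (is_lim_seq_composite (fun e => - INR (fact N) * rprod N e / INR (fact m))); [|exact He0].
    pose proof (rprod_derive_0 N) as H. pose proof (INR_fact_lt_0 m).
    auto_derive. repeat split; [eexists; exact H].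
Qed.

Lemma inv_shift_bounds (p : nat) : 0 < / (INR p + 2) <= 1 / 2.
Proof.
  pose proof (pos_INR p). split; [apply Rinv_0_lt_compat; lra|].
  replace (1 / 2) with (/ 2) by field. apply Rinv_le_contravar; lra.
Qed.

Lemma inv_shift_lim : is_lim_seq (fun p => / (INR p + 2)) 0.
Proof.
  evar_last; [apply is_lim_seq_inv|].
  - eapply is_lim_seq_plus; [apply is_lim_seq_INR|apply is_lim_seq_const|reflexivity].
  - easy.
  - reflexivity.
Qed.

Lemma log_coef_entire (n : nat) : entire (log_coef n).
Proof.
  apply entire_of_le with (coef_majorant n); [apply coef_majorant_entire|].
  intros m. apply (is_lim_seq_dominated (fun p => quotient_coef n (/ (INR p + 2)) m)).
  - apply quotient_coef_lim; [exact inv_shift_bounds|exact inv_shift_lim].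
  - intros p. apply quotient_coef_bound, inv_shift_bounds.
Qed.

(** * The Bessel function of the second kind at integer order *)

Lemma cos_sin_nat_shift (n : nat) (e : R) :
  cos ((INR n + e) * PI) = (-1) ^ n * cos (e * PI) /\
  sin ((INR n + e) * PI) = (-1) ^ n * sin (e * PI).
Proof.
  induction n as [|n [IHc IHs]].
  - simpl. rewrite Rplus_0_l. split; ring.
  - rewrite S_INR. replace ((INR n + 1 + e) * PI) with ((INR n + e) * PI + PI) by ring.
    rewrite neg_cos, neg_sin, IHc, IHs. simpl. split; ring.
Qed.

Lemma bessel_J_nat (n : nat) (z : R) :
  bessel_J (INR n) z = frobenius (INR n) (int_coef n) z.
Proof.
  unfold bessel_J, frobenius. f_equal. apply PSeries_ext. intros m.
  pose proof (rgamma_rprod (n + m) 0) as E.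
  rewrite Rplus_0_r, rgamma_1, rprod_0, plus_INR in E.
  replace (1 + (INR n + INR m)) with (INR m + INR n + 1) in E by ring.
  unfold int_coef. pose proof (INR_fact_lt_0 m). pose proof (INR_fact_lt_0 (n + m)).
  replace (rgamma (INR m + INR n + 1)) with (/ INR (fact (n + m))).
  - field. lra.
  - apply Rmult_eq_reg_l with (INR (fact (n + m))); [|lra].
    rewrite Rinv_r by lra. lra.
Qed.

Lemma shifted_coef_entire (n : nat) (e : R) : 0 < e <= 1 / 2 -> entire (shifted_coef n e).
Proof.
  intros He. apply (entire_of_le _ _ inv_fact_entire). intros m.
  now apply shifted_coef_bound.
Qed.

Lemma quotient_coef_entire (n : nat) (e : R) : 0 < e <= 1 / 2 -> entire (quotient_coef n e).
Proof.
  intros He. apply (entire_of_le _ _ (coef_majorant_entire n)). intros m.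
  now apply quotient_coef_bound.
Qed.

(** The part of [Y] of order [n + e] that has a computable limit: the difference
    quotients of the powers of [x/2] and of the coefficients. *)
Definition Y_regular (n : nat) (z e : R) : R :=
  e / sin (e * PI) *
  (Rpower (z / 2) (INR n) * PSeries (shifted_coef n e) ((z / 2) ^ 2)
     * (cos (e * PI) * rgamma (1 + e) * ((Rpower (z / 2) e - Rpower (z / 2) (- e)) / e))
   + rgamma (1 - e) * Rpower (z / 2) (- INR n) * Rpower (z / 2) (- e)
     * PSeries (quotient_coef n e) ((z / 2) ^ 2)).

(** Tends to [J / PI], so the gamma factors only add a multiple of [J] to the limit. *)
Definition Y_multiplier (n : nat) (z e : R) : R :=
  e / sin (e * PI) * Rpower (z / 2) (INR n) * Rpower (z / 2) (- e)
  * PSeries (shifted_coef n e) ((z / 2) ^ 2).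

Definition gamma_quotient (e : R) : R :=
  (cos (e * PI) * rgamma (1 + e) - rgamma (1 - e)) / e.

Lemma sin_small_pos (e : R) : 0 < e <= 1 / 2 -> 0 < sin (e * PI).
Proof. intros He. pose proof PI_RGT_0. apply sin_gt_0; nra. Qed.

(** Splits the difference quotient of a product of three factors (gamma factor,
    power of [x/2], series) into difference quotients of the factors. *)
Lemma bessel_Y_nonint_expansion (n : nat) (z e : R) : 0 < z -> 0 < e <= 1 / 2 ->
  bessel_Y_nonint (INR n + e) z =
  Y_regular n z e + gamma_quotient e * Y_multiplier n z e.
Proof.
  intros Hz He. set (q := (z / 2) ^ 2).
  assert (EJ : bessel_J (INR n + e) z = Rpower (z / 2) (INR n) * Rpower (z / 2) e *
    (rgamma (1 + e) * PSeries (shifted_coef n e) q)).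
  { unfold bessel_J. fold q. rewrite Rpower_plus, <- (PSeries_scal (rgamma (1 + e))). f_equal.
    apply PSeries_ext. intros m. apply bessel_J_coef_pos. lra. }
  assert (EK : bessel_J (- (INR n + e)) z = Rpower (z / 2) (- INR n) * Rpower (z / 2) (- e) *
    ((-1) ^ n * rgamma (1 - e) * (q ^ n * PSeries (shifted_coef n e) q
       - e * PSeries (quotient_coef n e) q))).
  { unfold bessel_J. fold q. rewrite Ropp_plus_distr, Rpower_plus. f_equal.
    assert (Hex : forall a, entire a -> ex_pseries a q).
    { intros a Ha. apply CV_radius_inside, entire_disk, Ha. }
    rewrite <- PSeries_incr_n, <- (PSeries_scal e), <- PSeries_minus,
      <- (PSeries_scal ((-1) ^ n * rgamma (1 - e))).
    - apply PSeries_ext. intros m. rewrite <- Ropp_plus_distr, bessel_J_coef_neg by lra.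
      reflexivity.
    - apply ex_pseries_incr_n. apply Hex, shifted_coef_entire, He.
    - apply ex_pseries_scal; [apply Rmult_comm|]. apply Hex, quotient_coef_entire, He. }
  unfold bessel_Y_nonint. rewrite EJ, EK.
  destruct (cos_sin_nat_shift n e) as [-> ->].
  unfold Y_regular, Y_multiplier, gamma_quotient. fold q.
  pose proof (sin_small_pos e He) as Hs. pose proof (neg1_pow_square n) as Hn.
  assert (Hn0 : (-1) ^ n <> 0) by (apply pow_nonzero; lra).
  assert (Eq : q ^ n = Rpower (z / 2) (INR n) * Rpower (z / 2) (INR n))
    by (now apply Rpower_half_square).
  pose proof (Rpower_half_opp (INR n) z) as HR.
  set (A := Rpower (z / 2) (INR n)) in *. set (B := Rpower (z / 2) (- INR n)) in *.
  set (PA := PSeries (shifted_coef n e) q). set (PD := PSeries (quotient_coef n e) q).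
  set (X := Rpower (z / 2) e). set (Y := Rpower (z / 2) (- e)).
  set (g := rgamma (1 + e)). set (g' := rgamma (1 - e)).
  set (c := cos (e * PI)). set (s := sin (e * PI)) in *.
  rewrite Eq.
  replace (B * Y * ((-1) ^ n * g' * (A * A * PA - e * PD))) with
    ((-1) ^ n * (g' * Y * ((A * B) * A * PA - B * e * PD))) by ring.
  rewrite HR. clearbody A B PA PD X Y g g' c s.
  replace (A * X * (g * PA) * ((-1) ^ n * c)) with ((-1) ^ n * (A * X * g * PA * c)) by ring.
  field. repeat split; lra.
Qed.

Lemma gamma_quotient_bound (e : R) : 0 < e <= 1 / 2 -> Rabs (gamma_quotient e) <= 4.
Proof.
  intros He. unfold gamma_quotient.
  pose proof (rgamma_right_of_1 e ltac:(lra)) as H1.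
  pose proof (rgamma_left_of_1 e ltac:(lra)) as H2.
  pose proof PI_RGT_0 as Hpi. pose proof PI_4 as H4.
  assert (Hc : 1 - e * PI <= cos (e * PI) <= 1).
  { split; [|apply COS_bound].
    replace (e * PI) with (2 * (e * PI / 2)) at 2 by field.
    rewrite cos_2a_sin.
    assert (0 < e * PI / 2) by nra.
    assert (0 <= sin (e * PI / 2)) by (apply sin_ge_0; nra).
    pose proof (sin_lt_x (e * PI / 2) H). pose proof (SIN_bound (e * PI / 2)). nra. }
  assert (Hc0 : 0 <= cos (e * PI)) by (apply cos_ge_0; nra).
  unfold Rdiv. rewrite Rabs_mult, (Rabs_pos_eq (/ e)) by (apply Rlt_le, Rinv_0_lt_compat; lra).
  apply Rle_div_l; [lra|]. apply Rabs_le. split; nra.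
Qed.

Lemma rgamma_near_1_lim (e : nat -> R) : (forall p, 0 < e p <= 1 / 2) -> is_lim_seq e 0 ->
  is_lim_seq (fun p => rgamma (1 + e p)) 1 /\ is_lim_seq (fun p => rgamma (1 - e p)) 1.
Proof.
  intros He He0. split.
  - apply is_lim_seq_le_le with (fun _ => 1) (fun p => 1 + e p).
    + intros p. specialize (He p). apply rgamma_right_of_1. lra.
    + apply is_lim_seq_const.
    + replace (Finite 1) with (Finite (1 + 0)) by (f_equal; ring).
      apply is_lim_seq_plus'; [apply is_lim_seq_const|exact He0].
  - apply is_lim_seq_le_le with (fun p => 1 - e p) (fun _ => 1).
    + intros p. specialize (He p). apply rgamma_left_of_1. lra.
    + replace (Finite 1) with (Finite (1 - 0)) by (f_equal; ring).
      apply is_lim_seq_minus'; [apply is_lim_seq_const|exact He0].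
    + apply is_lim_seq_const.
Qed.

(** The multiple [t] of [J] does not depend on [z], which is all that the cross
    product needs. *)
Lemma bessel_Y_nat : exists t, forall (n : nat) (z : R), 0 < z ->
  real (Lim (fun mu => bessel_Y_nonint mu z) (INR n)) =
  / PI * (log_solution n z + t * frobenius (INR n) (int_coef n) z).
Proof.
  set (e := fun p : nat => / (INR p + 2)).
  exists (real (Lim_seq (fun p => gamma_quotient (e p)))).
  intros n z Hz. unfold Lim. cbn [Rbar_loc_seq].
  assert (He : forall p, 0 < e p <= 1 / 2) by exact inv_shift_bounds.
  assert (He0 : is_lim_seq e 0) by exact inv_shift_lim.
  assert (Hne : forall p, e p <> 0) by (intros p; specialize (He p); lra).
  (* Dropping the first term makes the increments of the order at most [1/2]. *)
  rewrite <- Lim_seq_incr_1.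
  rewrite (Lim_seq_ext _ (fun p => Y_regular n z (e p) + gamma_quotient (e p) * Y_multiplier n z (e p))).
  2:{ intros p. rewrite S_INR. replace (INR p + 1 + 1) with (INR p + 2) by ring.
      now apply bessel_Y_nonint_expansion. }
  set (q := (z / 2) ^ 2).
  pose proof PI_RGT_0 as Hpi.
  assert (LA : is_lim_seq (fun p => PSeries (shifted_coef n (e p)) q) (PSeries (int_coef n) q)).
  { apply (PSeries_dominated _ _ _ _ inv_fact_entire).
    - intros p m. now apply shifted_coef_bound.
    - intros m. now apply shifted_coef_lim. }
  assert (LD : is_lim_seq (fun p => PSeries (quotient_coef n (e p)) q) (PSeries (log_coef n) q)).
  { apply (PSeries_dominated _ _ _ _ (coef_majorant_entire n)).
    - intros p m. now apply quotient_coef_bound.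
    - intros m. now apply quotient_coef_lim. }
  assert (LS : is_lim_seq (fun p => e p / sin (e p * PI)) (/ PI)).
  { apply is_lim_seq_ext with (fun p => / ((sin (e p * PI) - sin (0 * PI)) / e p)).
    - intros p. rewrite Rmult_0_l, sin_0. pose proof (sin_small_pos (e p) (He p)).
      specialize (Hne p). field. lra.
    - apply (is_lim_seq_inv _ (Finite PI)); [|intros h; injection h; lra].
      apply (is_lim_seq_difference_quotient (fun e => sin (e * PI))); auto.
      auto_derive; [easy|]. rewrite Rmult_0_l, cos_0. ring. }
  assert (LX : is_lim_seq (fun p => Rpower (z / 2) (- e p)) 1).
  { replace (Finite 1) with (Finite (Rpower (z / 2) (- 0)))
      by (unfold Rpower; now rewrite Ropp_0, Rmult_0_l, exp_0).
    apply (is_lim_seq_composite (fun e => Rpower (z / 2) (- e))); [|exact He0].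
    unfold Rpower. auto_derive. easy. }
  assert (LL : is_lim_seq (fun p => (Rpower (z / 2) (e p) - Rpower (z / 2) (- e p)) / e p)
    (2 * ln (z / 2))).
  { apply is_lim_seq_ext with (fun p =>
      ((fun e => Rpower (z / 2) e - Rpower (z / 2) (- e)) (e p)
       - (fun e => Rpower (z / 2) e - Rpower (z / 2) (- e)) 0) / e p).
    - intros p. rewrite Ropp_0. f_equal. ring.
    - apply (is_lim_seq_difference_quotient
        (fun e => Rpower (z / 2) e - Rpower (z / 2) (- e))); auto.
      unfold Rpower. auto_derive; [easy|]. rewrite Ropp_0, !Rmult_0_l, exp_0.
      unfold Rdiv. ring. }
  assert (LC : is_lim_seq (fun p => cos (e p * PI)) 1).
  { replace (Finite 1) with (Finite (cos (0 * PI))) by (now rewrite Rmult_0_l, cos_0).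
    apply (is_lim_seq_composite (fun e => cos (e * PI))); [|exact He0].
    auto_derive. easy. }
  destruct (rgamma_near_1_lim e He He0) as [LG LG'].
  rewrite (Lim_seq_bounded_combination (fun p => Y_regular n z (e p)) (fun p => Y_multiplier n z (e p))
    (fun p => gamma_quotient (e p)) (/ PI * log_solution n z)
    (/ PI * frobenius (INR n) (int_coef n) z) 4).
  - ring.
  - unfold Y_regular, log_solution, frobenius. fold q.
    apply is_lim_seq_mult'; [exact LS|].
    replace (2 * ln (z / 2) * (Rpower (z / 2) (INR n) * PSeries (int_coef n) q)
       + Rpower (z / 2) (- INR n) * PSeries (log_coef n) q) with
     (Rpower (z / 2) (INR n) * PSeries (int_coef n) q * (1 * 1 * (2 * ln (z / 2)))
      + 1 * Rpower (z / 2) (- INR n) * 1 * PSeries (log_coef n) q) by ring.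
    repeat first [assumption | apply is_lim_seq_const | apply is_lim_seq_plus' | apply is_lim_seq_mult'].
  - unfold Y_multiplier, frobenius. fold q.
    replace (/ PI * (Rpower (z / 2) (INR n) * PSeries (int_coef n) q)) with
      (/ PI * Rpower (z / 2) (INR n) * 1 * PSeries (int_coef n) q) by ring.
    repeat first [assumption | apply is_lim_seq_const | apply is_lim_seq_mult'].
  - intros p. now apply gamma_quotient_bound.
Qed.

(** * The bound on the zeros *)

Definition bessel_coef (nu : R) (m : nat) : R :=
  (-1) ^ m / INR (fact m) * rgamma (INR m + nu + 1).

Lemma bessel_coef_recurrence (nu : R) (m : nat) :
  frobenius_operator nu (bessel_coef nu) m = 0.
Proof.
  unfold frobenius_operator, bessel_coef.
  rewrite (rgamma_shift (INR m + nu + 1)), fact_S_INR, S_INR.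
  replace (INR m + 1 + nu + 1) with (INR m + nu + 1 + 1) by ring.
  pose proof (INR_fact_lt_0 m). pose proof (pos_INR m). simpl pow. field. lra.
Qed.

Lemma bessel_coef_entire (nu : R) : entire (bessel_coef nu).
Proof.
  destruct (nfloor_ex (Rabs nu) (Rabs_pos _)) as [N HN].
  apply (entire_of_ratio _ (S N) 1). intros m Hm.
  pose proof (bessel_coef_recurrence nu m) as H. unfold frobenius_operator in H.
  rewrite Rmult_1_l.
  replace (bessel_coef nu m) with (- (INR (S m) * (INR (S m) + nu) * bessel_coef nu (S m))) by lra.
  rewrite Rabs_Ropp, !Rabs_mult.
  apply le_INR in Hm. rewrite S_INR in Hm.
  pose proof (Rle_abs (- nu)) as Ha. rewrite Rabs_Ropp in Ha.
  pose proof (pos_INR N). rewrite S_INR.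
  rewrite (Rabs_pos_eq (INR m + 1)), (Rabs_pos_eq (INR m + 1 + nu)) by lra.
  apply Rmult_le_compat_r; [apply Rabs_pos|]. nra.
Qed.

Lemma bessel_J_frobenius (nu z : R) : bessel_J nu z = frobenius nu (bessel_coef nu) z.
Proof. reflexivity. Qed.

Lemma sin_nonint_neq_0 (nu : R) : frac_part nu <> 0 -> sin (nu * PI) <> 0.
Proof.
  intros Hf Hs. apply sin_eq_0_0 in Hs. destruct Hs as [k Hk].
  pose proof PI_RGT_0. apply Rmult_eq_reg_r in Hk; [|lra].
  apply Hf. rewrite Hk. destruct (Int_part_frac_part_spec (IZR k) k 0 ltac:(lra) ltac:(ring)) as [_ <-].
  reflexivity.
Qed.

(** Multiples of [u1] in the second solution cancel in the cross product.  Hence the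
    unknown multiple of [J] is harmless at integer order, and so is the term
    [cos (nu PI) J] at the other orders. *)
Lemma bessel_cross_pair (nu r : R) : 0 <= nu ->
  exists u1 v1 u2 v2 w c,
    bessel_solution nu u1 v1 /\ bessel_solution nu u2 v2 /\ w <> 0 /\
    (forall x, 0 < x -> wronskian u1 v1 u2 v2 x = w) /\
    (exists del, 0 < del /\ forall t, 0 < t < del -> 0 < u1 t) /\
    forall z, 0 < z -> 0 < r * z ->
      bessel_cross nu r z = c * (u1 (r * z) * u2 z - u1 z * u2 (r * z)).
Proof.
  intros Hnu. pose proof PI_RGT_0 as Hpi. destruct (Req_dec (frac_part nu) 0) as [Hf|Hf].
  - assert (E : nu = IZR (Int_part nu)) by (unfold frac_part in Hf; lra).
    destruct (IZN (Int_part nu)) as [n En]; [apply le_IZR; lra|].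
    rewrite En, <- INR_IZR_INZ in E. clear En. subst nu. destruct bessel_Y_nat as [t Ht].
    pose proof (log_coef_entire n) as Hd. pose proof (int_coef_entire n) as Hc.
    exists (frobenius (INR n) (int_coef n)), (frobenius_D (INR n) (int_coef n)),
      (log_solution n), (log_solution_D n), 2, (/ PI).
    split; [now apply frobenius_solution; [|apply int_coef_recurrence]|].
    split; [now apply log_solution_correct|].
    split; [lra|].
    split; [now apply log_solution_wronskian|].
    split.
    + apply frobenius_positive; [exact Hc|]. unfold int_coef. simpl pow.
      apply Rdiv_lt_0_compat; [lra|]. apply Rmult_lt_0_compat; apply INR_fact_lt_0.
    + intros z Hz Hrz. unfold bessel_cross, bessel_Y.
      destruct (Req_dec_T (frac_part (INR n)) 0) as [_|h];
        [|easy].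
      rewrite !Ht, !bessel_J_nat by assumption. ring.
  - pose proof (sin_nonint_neq_0 nu Hf) as Hs.
    assert (Hnz : forall k : Z, nu <> IZR k).
    { intros k ->. apply Hs. apply sin_eq_0_1. now exists k. }
    exists (frobenius nu (bessel_coef nu)), (frobenius_D nu (bessel_coef nu)),
      (frobenius (- nu) (bessel_coef (- nu))), (frobenius_D (- nu) (bessel_coef (- nu))),
      (- 2 * nu * bessel_coef nu 0 * bessel_coef (- nu) 0), (- / sin (nu * PI)).
    pose proof (bessel_coef_entire nu) as He. pose proof (bessel_coef_entire (- nu)) as He'.
    split; [now apply frobenius_solution, bessel_coef_recurrence|].
    split; [now apply bessel_solution_opp, frobenius_solution, bessel_coef_recurrence|].
    assert (H0 : forall mu, bessel_coef mu 0 = rgamma (1 + mu)).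
    { intros mu. unfold bessel_coef. simpl. replace (0 + mu + 1) with (1 + mu) by ring. field. }
    assert (Hnu0 : nu <> 0) by (apply (Hnz 0%Z)).
    assert (Hpos : 0 < rgamma (1 + nu)) by (apply rgamma_pos; lra).
    split.
    { rewrite !H0. repeat apply Rmult_integral_contrapositive_currified; try lra.
      apply rgamma_neq_0. intros k Hk. apply (Hnz (Z.of_nat k + 1)%Z).
      rewrite plus_IZR, <- INR_IZR_INZ. lra. }
    split; [now apply frobenius_wronskian; auto using bessel_coef_recurrence|].
    split; [apply frobenius_positive; [exact He|now rewrite H0]|].
    intros z Hz Hrz. unfold bessel_cross, bessel_Y, bessel_Y_nonint.
    destruct (Req_dec_T (frac_part nu) 0) as [h|_]; [easy|].
    rewrite !bessel_J_frobenius. field. exact Hs.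
Qed.

Lemma bessel_solution_neg (nu : R) (u v : R -> R) : bessel_solution nu u v ->
  bessel_solution nu (fun x => - u x) (fun x => - v x).
Proof.
  intros H x Hx. destruct (H x Hx) as [Hu Hv]. split; auto_derive.
  1, 3: repeat split; eexists; eassumption.
  - rewrite (Derive_value _ _ _ Hu). field. lra.
  - rewrite (Derive_value _ _ _ Hv). field. lra.
Qed.

(** The sign of the Wronskian is made positive by replacing [u2] by its opposite. *)
Lemma bessel_cross_many_zeros (nu r : R) (k : nat) : 0 <= nu -> 1 < r -> (1 <= k)%nat ->
  exists l, NoDup l /\ length l = k /\ forall z, In z l ->
    0 < z < PI * INR k / (r - 1) + PI * nu / (2 * r) /\ bessel_cross nu r z = 0.
Proof.
  intros Hnu Hr Hk.
  destruct (bessel_cross_pair nu r Hnu)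
    as (u1 & v1 & u2 & v2 & w & c & H1 & H2 & Hw & HW & [del [Hd Hdp]] & Hf).
  assert (Hl : exists l, NoDup l /\ length l = k /\ forall z, In z l ->
    0 < z < PI * INR k / (r - 1) + PI * nu / (2 * r) /\
    u1 (r * z) * u2 z - u1 z * u2 (r * z) = 0).
  { destruct (Rlt_dec 0 w) as [h|h].
    - apply (many_cross_zeros nu w u1 v1 u2 v2 del r k); auto. exact (conj H1 (conj H2 (conj h HW))).
    - destruct (many_cross_zeros nu (- w) u1 v1 (fun x => - u2 x) (fun x => - v2 x) del r k)
        as (l & L1 & L2 & L3); auto.
      + split; [exact H1|]. split; [now apply bessel_solution_neg|]. split; [lra|].
        intros x Hx. rewrite <- (HW x Hx). unfold wronskian. ring.
      + exists l. split; [exact L1|]. split; [exact L2|]. intros z Hz.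
        destruct (L3 z Hz). split; [assumption|lra]. }
  destruct Hl as (l & L1 & L2 & L3). exists l. split; [exact L1|]. split; [exact L2|].
  intros z Hz. destruct (L3 z Hz) as [Hz' E]. split; [exact Hz'|].
  rewrite Hf, E by nra. ring.
Qed.

Theorem theorem1p2 :
  forall (r nu : R) (k : nat) (a : R),
    1 < r -> 0 <= nu -> (1 <= k)%nat ->
    is_kth_pos_zero (bessel_cross nu r) k a ->
    a < PI * INR k / (r - 1) + PI * nu / (2 * r).
Proof.
  intros r nu k a Hr Hnu Hk (Ha & _ & l & Hl & Hlk & Hlz).
  apply Rnot_le_lt. intros Hle.
  destruct (bessel_cross_many_zeros nu r k Hnu Hr Hk) as (l' & H1 & H2 & H3).
  assert (Hincl : incl l' l).
  { intros z Hz. destruct (H3 z Hz) as [Hz1 Hz2]. apply Hlz. split; [lra|exact Hz2]. }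
  pose proof (NoDup_incl_length H1 Hincl). lia.
Qed.
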